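(* Define integer sequences $A(n)$, $B(n)$, $D(n)$ ($n\geq 0$) by the power series expansions, valid for $|q|<1$, \[ \sum_{n=0}^{\infty}A(n)q^{n}=\frac{(q^{2};q^{5})_{\infty}^{5}(q^{3};q^{5})_{\infty}^{5}}{(q;q^{5})_{\infty}^{5}(q^{4};q^{5})_{\infty}^{5}},\qquad \sum_{n=0}^{\infty}B(n)q^{n}=\frac{(q;q^{5})_{\infty}^{5}(q^{4};q^{5})_{\infty}^{5}}{(q^{2};q^{5})_{\infty}^{5}(q^{3};q^{5})_{\infty}^{5}}, \] \[ \sum_{n=0}^{\infty}D(n)q^{n}=\frac{(q^{5};q^{25})_{\infty}(q^{20};q^{25})_{\infty}}{(q^{10};q^{25})_{\infty}(q^{15};q^{25})_{\infty}}\cdot\frac{(q^{2};q^{5})_{\infty}^{5}(q^{3};q^{5})_{\infty}^{5}}{(q;q^{5})_{\infty}^{5}(q^{4};q^{5})_{\infty}^{5}}. \] Then $A(5n)<0$ and $B(5n)<0$ for all integers $n\geq 1$, and $D(5n+1)>0$ for all integers $n\geq 0$.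
   Context: For a complex number $a$ and $|q|<1$, $(a;q)_{\infty}:=\prod_{k=0}^{\infty}(1-aq^{k})$. (Equivalently, with $R(q)=q^{1/5}\frac{(q;q^5)_\infty(q^4;q^5)_\infty}{(q^2;q^5)_\infty(q^3;q^5)_\infty}$ the Rogers--Ramanujan continued fraction, the three series are $1/R^5(q)$, $R^5(q)$ and $R(q^5)/R^5(q)$.) *)

(* Defs.v *)
From HB Require Import structures.
From mathcomp Require Export all_boot all_order all_algebra.
From mathcomp Require Export all_classical all_reals all_analysis.
From mathcomp.real_closed Require Export complex.

Set Implicit Arguments.
Unset Strict Implicit.
Unset Printing Implicit Defensive.

Export Order.TTheory GRing.Theory Num.Theory.
Export numFieldNormedType.Exports.

Local Open Scope classical_set_scope.
Local Open Scope ring_scope.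

(* Both definitions are meant for K := R[i]; they are generic in K because the
   norm topology is attached to the numFieldType structure, not to the carrier
   type complex R. *)

(* (a; q)_oo.  [lim] is total; the partial products do converge when `|q| < 1. *)
Definition qpoch (K : numFieldType) (a q : K) : K :=
  lim ((fun n : nat => \prod_(k < n) (1 - a * q ^+ k)) @ \oo).

Definition is_qexpansion (K : numFieldType) (c : nat -> int) (F : K -> K) :=
  forall q : K, `|q| < 1 ->
    series (fun n : nat => (c n)%:~R * q ^+ n) @ \oo --> F q.

(* Main.v *)
From HB Require Import structures.
Require Import Defs.
From mathcomp Require Import ring zify.

(* Work in K[[q]] with f = (q,q^4;q^5)/(q^2,q^3;q^5) and g = 1/f, so that the three
   series are g^5, f^5 and f(q^5) g^5.  Write E_k = (q^k;q^k) and e = E_5/E_1.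
   By the Jacobi triple product E_1 E_5 is a double theta series; multiplication by a
   Gaussian integer of norm 5 splits it into five cosets, two of which cancel, and this
   gives E_1 = E_25 (g(q^5) - q - q^2 f(q^5)).  The product of this identity over
   q -> zeta q, zeta^5 = 1, gives E_1^6 = E_5^6 (g^5 - 11 q - q^2 f^5).  Together they say
   that q f^5 is a root of a quadratic equation over the field generated by
   v = q f(q^5), and the other root has a pole, so f^5 is an explicit rational function of v:
     q f^5 = v (1 - 2v + 4v^2 - 3v^3 + v^4) / (1 + 3v + 4v^2 + 2v^3 + v^4).
   Since v^k only involves exponents congruent to k mod 5, the sections can be read off:
     sum A(5n) q^n   = g - 25 q g e^6,
     sum B(5n) q^n   = f - 25 q f e^6,
     sum D(5n+1) q^n = 5 f + 15 q f e^6 + 5 q^2 (f e)^6.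
   Here f e and g e are products of factors 1/(1 - q^m), the coefficients of f and g are
   bounded by those of e, and e - 1 <= q e / (1 - q) coefficientwise, which gives
   the signs. *)

Set Implicit Arguments.
Unset Strict Implicit.
Unset Printing Implicit Defensive.

Local Open Scope ring_scope.

(** * Formal power series *)

(** A wrapper, so that the Cauchy product does not compete with the pointwise ring structure on
    functions. *)
Record fps (K : Type) := Fps { fcoef : nat -> K }.

Lemma fpsP (K : Type) (f g : fps K) : fcoef f =1 fcoef g -> f = g.
Proof. by case: f g => [f] [g] /= /funext ->. Qed.

HB.instance Definition _ (K : Type) := gen_eqMixin (fps K).
HB.instance Definition _ (K : Type) := gen_choiceMixin (fps K).

Section FpsRing.
Variable K : comNzRingType.
Implicit Types f g h : fps K.

Definition fps_add f g := Fps (fun n => fcoef f n + fcoef g n).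
Definition fps_opp f := Fps (fun n => - fcoef f n).
Definition fps_const (c : K) := Fps (fun n => if n == 0%N then c else 0).
Definition fps_mul f g :=
  Fps (fun n => \sum_(i < n.+1) fcoef f i * fcoef g (n - i)%N).
Definition ftrunc L f : {poly K} := \poly_(i < L) fcoef f i.

Lemma coef_ftrunc L f i : (i < L)%N -> (ftrunc L f)`_i = fcoef f i.
Proof. by move=> iL; rewrite coef_poly iL. Qed.

(** Through truncations the ring laws of the Cauchy product are inherited from [{poly K}]. *)
Lemma fps_mul_trunc L f g n : (n < L)%N ->
  fcoef (fps_mul f g) n = (ftrunc L f * ftrunc L g)`_n.
Proof.
move=> nL; rewrite coefM /=; apply: eq_bigr => i _.
have iL : (i < L)%N := leq_trans (ltn_ord i) nL.
by rewrite !coef_ftrunc // (leq_ltn_trans (leq_subr _ _)).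
Qed.

Lemma fps_addA : associative fps_add.
Proof. by move=> f g h; apply: fpsP => n /=; rewrite addrA. Qed.
Lemma fps_addC : commutative fps_add.
Proof. by move=> f g; apply: fpsP => n /=; rewrite addrC. Qed.
Lemma fps_add0 : left_id (fps_const 0) fps_add.
Proof. by move=> f; apply: fpsP => n /=; rewrite if_same add0r. Qed.
Lemma fps_addN : left_inverse (fps_const 0) fps_opp fps_add.
Proof. by move=> f; apply: fpsP => n /=; rewrite if_same addNr. Qed.

HB.instance Definition _ := GRing.isZmodule.Build (fps K)
  fps_addA fps_addC fps_add0 fps_addN.

Lemma fps_mulC : commutative fps_mul.
Proof.
by move=> f g; apply: fpsP => n; rewrite !(@fps_mul_trunc n.+1) // mulrC.
Qed.
Lemma fps_mulA : associative fps_mul.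
Proof.
move=> f g h; apply: fpsP => n; rewrite !(@fps_mul_trunc n.+1) //.
transitivity (ftrunc n.+1 f * ftrunc n.+1 g * ftrunc n.+1 h)`_n.
  rewrite -mulrA !coefM; apply: eq_bigr => i _; congr (_ * _).
  have lin : (n - i < n.+1)%N by lia.
  by rewrite coef_ftrunc // (@fps_mul_trunc n.+1).
rewrite !coefM; apply: eq_bigr => i _; congr (_ * _).
by rewrite coef_ftrunc // (@fps_mul_trunc n.+1).
Qed.
Lemma fps_mul1 : left_id (fps_const 1) fps_mul.
Proof.
move=> f; apply: fpsP => n /=.
rewrite big_ord_recl /= mul1r subn0 big1 ?addr0 // => i _.
by rewrite mul0r.
Qed.
Lemma fps_mulDl : left_distributive fps_mul fps_add.
Proof.
move=> f g h; apply: fpsP => n /=.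
by rewrite -big_split /=; apply: eq_bigr => i _; rewrite mulrDl.
Qed.
Lemma fps_1neq0 : fps_const 1 != fps_const 0.
Proof.
apply/eqP => /(congr1 (fun f => fcoef f 0)) /= /eqP; rewrite oner_eq0.
done.
Qed.

HB.instance Definition _ := GRing.Zmodule_isComNzRing.Build (fps K)
  fps_mulA fps_mulC fps_mul1 fps_mulDl fps_1neq0.

Lemma fcoef0 n : fcoef (0 : fps K) n = 0. Proof. by rewrite /= if_same. Qed.
Lemma fcoef1 n : fcoef (1 : fps K) n = (n == 0%N)%:R.
Proof. by rewrite /=; case: ifP. Qed.
Lemma fcoefD f g n : fcoef (f + g) n = fcoef f n + fcoef g n. Proof. by []. Qed.
Lemma fcoefN f n : fcoef (- f) n = - fcoef f n. Proof. by []. Qed.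
Lemma fcoefB f g n : fcoef (f - g) n = fcoef f n - fcoef g n. Proof. by []. Qed.
Lemma fcoefM f g n :
  fcoef (f * g) n = \sum_(i < n.+1) fcoef f i * fcoef g (n - i)%N.
Proof. by []. Qed.
Lemma fcoef_sum (I : Type) (r : seq I) (P : pred I) (F : I -> fps K) n :
  fcoef (\sum_(i <- r | P i) F i) n = \sum_(i <- r | P i) fcoef (F i) n.
Proof. by elim/big_rec2: _ => [|i x y _ <-]; rewrite ?fcoef0 ?fcoefD. Qed.
Lemma fcoefMn f m n : fcoef (f *+ m) n = fcoef f n *+ m.
Proof. by elim: m => [|m IH]; rewrite ?fcoef0 // !mulrS fcoefD IH. Qed.

Definition fX : fps K := Fps (fun n => (n == 1%N)%:R).

Lemma fcoefXM f n : fcoef (fX * f) n = if n is m.+1 then fcoef f m else 0.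
Proof.
rewrite fcoefM; case: n => [|n]; first by rewrite big_ord1 /= mul0r.
rewrite big_ord_recl /= mul0r add0r big_ord_recl /= mul1r big1 ?addr0.
  by rewrite /bump /= subn1.
by move=> i _; rewrite /bump /= mul0r.
Qed.

Lemma fcoefXnM f m n :
  fcoef (fX ^+ m * f) n = if (m <= n)%N then fcoef f (n - m)%N else 0.
Proof.
elim: m n => [|m IH] n; first by rewrite expr0 mul1r subn0.
by rewrite exprS -mulrA fcoefXM; case: n => [|n] //; rewrite IH.
Qed.

Lemma fcoefXn m n : fcoef (fX ^+ m) n = (n == m)%:R.
Proof.
rewrite -[fX ^+ m]mulr1 fcoefXnM fcoef1.
by case: ltngtP => // [nm|->]; rewrite ?subnn // eqn0Ngt subn_gt0 nm.
Qed.

End FpsRing.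

(** * Congruence modulo powers of q, and infinite products *)

Section Congruence.
Variable K : comNzRingType.
Implicit Types f g h : fps K.
Local Notation X := (fX K).

Definition eqm N f g := forall n, (n < N)%N -> fcoef f n = fcoef g n.

Lemma eqm_refl N f : eqm N f f. Proof. by []. Qed.
Lemma eqm_sym N f g : eqm N f g -> eqm N g f.
Proof. by move=> H n /H. Qed.
Lemma eqm_trans N f g h : eqm N f g -> eqm N g h -> eqm N f h.
Proof. by move=> H1 H2 n nN; rewrite H1 // H2. Qed.
Lemma eqm_le M N f g : (M <= N)%N -> eqm N f g -> eqm M f g.
Proof. by move=> MN H n nM; apply: H; lia. Qed.
Lemma eqmP f g : (forall N, eqm N f g) -> f = g.
Proof. by move=> H; apply: fpsP => n; apply: (H n.+1). Qed.
Lemma eqmD N f g f' g' : eqm N f f' -> eqm N g g' -> eqm N (f + g) (f' + g').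
Proof. by move=> H1 H2 n nN; rewrite !fcoefD H1 // H2. Qed.
Lemma eqmM N f g f' g' : eqm N f f' -> eqm N g g' -> eqm N (f * g) (f' * g').
Proof.
move=> H1 H2 n nN; rewrite !fcoefM; apply: eq_bigr => i _.
by have iL := ltn_ord i; rewrite H1 ?H2 //; lia.
Qed.
Lemma eqm_sum N (I : Type) (r : seq I) (P : pred I) (F G : I -> fps K) :
  (forall i, P i -> eqm N (F i) (G i)) ->
  eqm N (\sum_(i <- r | P i) F i) (\sum_(i <- r | P i) G i).
Proof. by move=> H; elim/big_ind2: _ => // *; apply: eqmD. Qed.
Lemma eqm_prod N (I : Type) (r : seq I) (P : pred I) (F G : I -> fps K) :
  (forall i, P i -> eqm N (F i) (G i)) ->
  eqm N (\prod_(i <- r | P i) F i) (\prod_(i <- r | P i) G i).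
Proof. by move=> H; elim/big_ind2: _ => // *; apply: eqmM. Qed.

(** Factors from the n-th on do not affect coefficients up to degree n, so [iprod] may read its n-th
    coefficient off the first n factors. *)
Definition convergent_factors (u : nat -> fps K) :=
  forall k, eqm k.+1 (u k) 1.

Definition iprod (u : nat -> fps K) :=
  Fps (fun n => fcoef (\prod_(k < n) u k) n).

Lemma eqm_prod_tail (u : nat -> fps K) M N : convergent_factors u -> (M <= N)%N ->
  eqm M.+1 (\prod_(k < N) u k) (\prod_(k < M) u k).
Proof.
move=> cu; elim: N => [|N IH]; first by case: M.
rewrite leq_eqVlt => /orP[/eqP -> //|MN].
rewrite big_ord_recr /= -[X in eqm _ _ X]mulr1; apply: eqmM; first exact: IH.
exact: eqm_le (cu N).
Qed.

Lemma eqm_iprod (u : nat -> fps K) N : convergent_factors u ->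
  eqm N.+1 (iprod u) (\prod_(k < N) u k).
Proof. by move=> cu n nN; rewrite (eqm_prod_tail cu (ltnSE nN)). Qed.

Lemma iprodM (u v : nat -> fps K) : convergent_factors u -> convergent_factors v ->
  iprod u * iprod v = iprod (fun k => u k * v k).
Proof.
move=> cu cv; have cuv : convergent_factors (fun k => u k * v k).
  by move=> k; rewrite -[X in eqm _ _ X]mulr1; apply: eqmM.
apply: eqmP => N; apply: (@eqm_le _ N.+1) => //.
apply: (eqm_trans _ (eqm_sym (eqm_iprod cuv))).
by rewrite big_split /=; apply: eqmM; apply: eqm_iprod.
Qed.

Lemma iprod1 : iprod (fun=> 1) = 1.
Proof. by apply: fpsP => n; rewrite [LHS]/= big1. Qed.

Lemma fps_lreg (K' : idomainType) (f g : fps K') :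
  fcoef f 0 != 0 -> f * g = 0 -> g = 0.
Proof.
move=> f0 fg0; apply: fpsP; elim/ltn_ind => n IH.
have := congr1 (fun p : fps K' => fcoef p n) fg0.
rewrite fcoefM big_ord_recl subn0 big1 ?addr0.
  by rewrite !fcoef0 => /eqP; rewrite mulf_eq0 (negPf f0) => /eqP.
move=> i _; rewrite IH ?fcoef0 ?mulr0 //= /bump /=.
by have := ltn_ord i; lia.
Qed.

Lemma fps_mulI (K' : idomainType) (f g h : fps K') :
  fcoef f 0 != 0 -> f * g = f * h -> g = h.
Proof.
move=> f0 fgh; apply/subr0_eq/(fps_lreg f0).
by rewrite mulrBr fgh subrr.
Qed.

Lemma fcoef0M f g : fcoef (f * g) 0 = fcoef f 0 * fcoef g 0.
Proof. by rewrite fcoefM big_ord1. Qed.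
Lemma fcoef0X f n : fcoef (f ^+ n) 0 = fcoef f 0 ^+ n.
Proof. by elim: n => [|n IH]; rewrite ?fcoef1 // !exprS fcoef0M IH. Qed.

(** The series 1/(1 - q^k), for k > 0. *)
Definition geo k := Fps (fun n => ((k %| n)%N%:R : K)).

Lemma geoE k : (0 < k)%N -> (1 - X ^+ k) * geo k = 1.
Proof.
move=> k0; apply: fpsP => n; rewrite mulrBl mul1r fcoefB fcoefXnM fcoef1 /=.
case: leqP => kn; last by case: n kn => [|n] kn; rewrite subr0 ?dvdn0 // gtnNdvd.
by rewrite dvdn_subl ?dvdnn // subrr; case: n kn => //; lia.
Qed.

(** The product (q^a; q^b)_oo. Its reciprocal [ipoch] is built from geometric series, which makes
    its coefficients visibly nonnegative. *)
Definition poch a b := iprod (fun k => 1 - X ^+ (a + b * k)).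
Definition ipoch a b := iprod (fun k => geo (a + b * k)).

Lemma eqm_1BXn m : eqm m (1 - X ^+ m) 1.
Proof. by move=> n nm; rewrite fcoefB fcoefXn (ltn_eqF nm) subr0. Qed.
Lemma eqm_geo m : eqm m (geo m) 1.
Proof.
move=> n nm; rewrite fcoef1 /=; case: n nm => [|n] nm; rewrite ?dvdn0 //.
by rewrite gtnNdvd.
Qed.

Lemma cvf_poch a b : (0 < a)%N -> (0 < b)%N ->
  convergent_factors (fun k => 1 - X ^+ (a + b * k)).
Proof. by move=> a0 b0 k; apply: eqm_le (@eqm_1BXn _); nia. Qed.
Lemma cvf_ipoch a b : (0 < a)%N -> (0 < b)%N ->
  convergent_factors (fun k => geo (a + b * k)).
Proof. by move=> a0 b0 k; apply: eqm_le (@eqm_geo _); nia. Qed.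

Lemma poch_ipoch a b : (0 < a)%N -> (0 < b)%N -> poch a b * ipoch a b = 1.
Proof.
move=> a0 b0; rewrite iprodM; [|exact: cvf_poch|exact: cvf_ipoch].
rewrite -[RHS]iprod1; congr iprod; apply/funext => k; apply: geoE; lia.
Qed.

Lemma poch_0 a b : fcoef (poch a b) 0 = 1.
Proof. by rewrite [LHS]/= big_ord0 fcoef1. Qed.
Lemma ipoch_0 a b : fcoef (ipoch a b) 0 = 1.
Proof. by rewrite [LHS]/= big_ord0 fcoef1. Qed.

(** Factors are sorted by their index modulo 5; 5N factors on the left against N per class on the
    right give a finite identity. *)
Lemma poch_split5 a : (0 < a)%N ->
  poch a a = poch a (5 * a) * poch (2 * a) (5 * a) * poch (3 * a) (5 * a) *
             poch (4 * a) (5 * a) * poch (5 * a) (5 * a).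
Proof.
move=> a0; apply: eqmP => N; apply: (@eqm_le _ N.+1) => //.
apply: (@eqm_trans _ _ (\prod_(k < 5 * N) (1 - X ^+ (a + a * k)))).
  by apply: (@eqm_le _ (5 * N).+1); [lia|apply: eqm_iprod; apply: cvf_poch].
apply: eqm_sym; rewrite (_ : \prod_(k < 5 * N) _ =
  (\prod_(k < N) (1 - X ^+ (a + 5 * a * k))) *
  (\prod_(k < N) (1 - X ^+ (2 * a + 5 * a * k))) *
  (\prod_(k < N) (1 - X ^+ (3 * a + 5 * a * k))) *
  (\prod_(k < N) (1 - X ^+ (4 * a + 5 * a * k))) *
  (\prod_(k < N) (1 - X ^+ (5 * a + 5 * a * k)))).
  by do !apply: eqmM; apply: eqm_iprod; apply: cvf_poch; lia.
elim: N => [|N IH]; first by rewrite !big_ord0 !mulr1.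
rewrite mulnSr !addnS addn0 !big_ord_recr IH /=.
set e1 := (a + a * (5 * N))%N; set e2 := (a + a * (5 * N).+1)%N.
set e3 := (a + a * (5 * N).+2)%N; set e4 := (a + a * (5 * N).+3)%N.
set e5 := (a + a * (5 * N).+4)%N.
have -> : (a + 5 * a * N = e1)%N by rewrite /e1; lia.
have -> : (2 * a + 5 * a * N = e2)%N by rewrite /e2; lia.
have -> : (3 * a + 5 * a * N = e3)%N by rewrite /e3; lia.
have -> : (4 * a + 5 * a * N = e4)%N by rewrite /e4; lia.
have -> : (5 * a + 5 * a * N = e5)%N by rewrite /e5; lia.
ring.
Qed.

End Congruence.

(** * The substitutions q -> q^5 and q -> zq, and sections modulo 5 *)

Section Subst.
Variable K : comNzRingType.
Implicit Types f g h : fps K.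
Local Notation X := (fX K).

Definition sub5 f := Fps (fun n => if (5 %| n)%N then fcoef f (n %/ 5) else 0).
Definition dil (z : K) f := Fps (fun n => z ^+ n * fcoef f n).
Definition sect5 r f := Fps (fun n => fcoef f (5 * n + r)).

Lemma sub5B : {morph sub5 : f g / f - g}.
Proof. by move=> f g; apply: fpsP => n /=; case: ifP => _ //; rewrite subr0. Qed.
Lemma sub5_1 : sub5 1 = 1.
Proof. by apply: fpsP => -[|n] //=; case: ifP => // H; case: ifP => //; lia. Qed.
Lemma sub5M : {morph sub5 : f g / f * g}.
Proof.
move=> f g; apply: fpsP => n.
rewrite [RHS](@fps_mul_trunc _ n.+1) //.
have E h i : (i < n.+1)%N ->
    (ftrunc n.+1 (sub5 h))`_i = (ftrunc n.+1 h \Po 'X^5)`_i.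
  move=> iN; rewrite coef_comp_poly_Xn // coef_ftrunc //=.
  by case: ifP => // _; rewrite coef_ftrunc //; lia.
transitivity ((ftrunc n.+1 f \Po 'X^5) * (ftrunc n.+1 g \Po 'X^5))`_n.
  rewrite -comp_polyM coef_comp_poly_Xn //=; case: ifP => // _.
  by rewrite -(@fps_mul_trunc _ n.+1) //; lia.
by rewrite !coefM; apply: eq_bigr => i _; rewrite !E //; lia.
Qed.
HB.instance Definition _ := GRing.isZmodMorphism.Build _ _ sub5 sub5B.
HB.instance Definition _ := GRing.isMonoidMorphism.Build _ _ sub5 (conj sub5_1 sub5M).

Lemma sub5_inj : injective sub5.
Proof.
move=> f g fg; apply: fpsP => n; have := congr1 (fun h => fcoef h (5 * n)%N) fg.
by rewrite /= dvdn_mulr // mulKn.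
Qed.
Lemma sub5X : sub5 X = X ^+ 5.
Proof.
apply: fpsP => n; rewrite fcoefXn /=; case: ifP => [/dvdnP[m ->]|H].
  by rewrite mulnK //; congr _%:R; lia.
by case: eqP => // E; rewrite E in H.
Qed.
Lemma eqm_sub5 N f g : eqm N f g -> eqm N (sub5 f) (sub5 g).
Proof. by move=> H n nN /=; case: ifP => // _; apply: H; lia. Qed.

Lemma sub5_poch a b : (0 < a)%N -> (0 < b)%N ->
  sub5 (poch K a b) = poch K (5 * a) (5 * b).
Proof.
move=> a0 b0; apply: eqmP => N; apply: (@eqm_le _ _ N.+1) => //.
apply: eqm_trans (eqm_sub5 (eqm_iprod (cvf_poch K a0 b0))) _.
apply: (eqm_trans _ (eqm_sym (eqm_iprod (cvf_poch _ _ _)))); [|lia|lia].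
rewrite rmorph_prod /=; apply: eqm_prod => k _.
by rewrite rmorphB rmorph1 rmorphXn /= sub5X -exprM mulnDr mulnA.
Qed.

Lemma dilB z : {morph dil z : f g / f - g}.
Proof. by move=> f g; apply: fpsP => n /=; rewrite mulrBr. Qed.
Lemma dil_1 z : dil z 1 = 1.
Proof. by apply: fpsP => -[|n] /=; rewrite ?mulr0 // mulr1. Qed.
Lemma dilM z : {morph dil z : f g / f * g}.
Proof.
move=> f g; apply: fpsP => n /=; rewrite mulr_sumr; apply: eq_bigr => i _.
by rewrite mulrACA -exprD; congr (_ ^+ _ * _); have := ltn_ord i; lia.
Qed.
HB.instance Definition _ z := GRing.isZmodMorphism.Build _ _ (dil z) (dilB z).
HB.instance Definition _ z := GRing.isMonoidMorphism.Build _ _ (dil z) (conj (dil_1 z) (dilM z)).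

Lemma dilX z : dil z X = fps_const z * X.
Proof.
apply: fpsP => n; rewrite mulrC fcoefXM /=.
by case: n => [|[|n]] /=; rewrite ?mulr0 ?mulr1 ?expr1.
Qed.
Lemma dil_sub5 z f : z ^+ 5 = 1 -> dil z (sub5 f) = sub5 f.
Proof.
move=> fifth_root_exp5; apply: fpsP => n /=; case: ifP => [/dvdnP[m ->]|_]; last by rewrite mulr0.
by rewrite mulnC exprM fifth_root_exp5 expr1n mul1r.
Qed.
Lemma eqm_dil N z f g : eqm N f g -> eqm N (dil z f) (dil z g).
Proof. by move=> H n nN /=; rewrite H. Qed.

Lemma fps_constM : {morph @fps_const K : x y / x * y}.
Proof.
move=> x y; apply: fpsP => n; rewrite fcoefM big_ord_recl /= subn0.
rewrite big1 ?addr0; last by move=> i _; rewrite mul0r.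
by case: n => // n; rewrite mulr0.
Qed.
Lemma fps_constB : {morph @fps_const K : x y / x - y}.
Proof. by move=> x y; apply: fpsP => n /=; case: ifP; rewrite ?subr0. Qed.
HB.instance Definition _ := GRing.isZmodMorphism.Build _ _ (@fps_const K) fps_constB.
HB.instance Definition _ := GRing.isMonoidMorphism.Build _ _ (@fps_const K) (conj erefl fps_constM).

Lemma sect5D r : {morph sect5 r : f g / f + g}.
Proof. by move=> f g; apply: fpsP. Qed.
Lemma sect5N r : {morph sect5 r : f / - f}.
Proof. by move=> f; apply: fpsP. Qed.
Lemma sect5_sum_dvd n (F : nat -> K) :
  \sum_(i < n.+1 | (5 %| i)%N) F i = \sum_(j < (n %/ 5).+1) F (5 * j)%N.
Proof.
elim: n => [|n IH]; first by rewrite !big_mkcond !big_ord1 /= muln0.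
rewrite big_mkcond big_ord_recr -big_mkcond /= IH; case: ifP => [|H].
  case/dvdnP => m E.
  have -> : (n.+1 %/ 5 = (n %/ 5).+1)%N by lia.
  rewrite [RHS]big_ord_recr /=; congr (_ + F _); lia.
by rewrite addr0; have -> : (n.+1 %/ 5 = n %/ 5)%N by lia.
Qed.
(** Only indices divisible by 5 contribute from [sub5 f], so taking a section is linear over series
    in q^5. *)
Lemma sect5_sub5M r f g : (r < 5)%N -> sect5 r (sub5 f * g) = f * sect5 r g.
Proof.
move=> r5; apply: fpsP => n; rewrite [LHS]/= [RHS]/=.
rewrite (eq_bigr (fun i : 'I_(5 * n + r).+1 => if (5 %| i)%N then
   fcoef f (i %/ 5) * fcoef g (5 * n + r - i)%N else 0)); last first.
  by move=> i _; case: ifP => // _; rewrite mul0r.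
rewrite -big_mkcond (@sect5_sum_dvd _ (fun i => fcoef f (i %/ 5) * fcoef g (5 * n + r - i)%N)).
have -> : ((5 * n + r) %/ 5 = n)%N by lia.
apply: eq_bigr => i _; rewrite mulKn //; congr (_ * fcoef g _).
by have := ltn_ord i; lia.
Qed.
Lemma sect5_sub5Xn r f k : (r < 5)%N ->
  sect5 r (sub5 f * X ^+ k) = if (k %% 5 == r)%N then f * X ^+ (k %/ 5) else 0.
Proof.
move=> r5; rewrite sect5_sub5M //; case: ifP => E; last first.
  rewrite (_ : sect5 r _ = 0) ?mulr0 //; apply: fpsP => n.
  by rewrite fcoef0 [LHS]fcoefXn; case: eqP => //; lia.
by congr (_ * _); apply: fpsP => n; rewrite [LHS]fcoefXn fcoefXn; congr _%:R; lia.
Qed.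
End Subst.

(** * The Jacobi triple product *)

Section GaussBinomial.
Variables (A : comNzRingType) (y : A).

(** Gaussian binomial coefficients in base [y], by the q-Pascal rule, which avoids division. *)
Fixpoint gbin n j : A :=
  match n, j with
  | _, 0 => 1
  | 0, _.+1 => 0
  | n'.+1, j'.+1 => gbin n' j' + y ^+ j'.+1 * gbin n' j'.+1
  end.

Arguments gbin : simpl never.

Definition qfact n : A := \prod_(k < n) (1 - y ^+ k.+1).

Lemma gbin0 n : gbin n 0 = 1. Proof. by case: n. Qed.
Lemma gbinS n j : gbin n.+1 j.+1 = gbin n j + y ^+ j.+1 * gbin n j.+1.
Proof. by []. Qed.
Lemma gbin_small n j : (n < j)%N -> gbin n j = 0.
Proof.
elim: n j => [|n IH] [|j] // nj.
by rewrite gbinS !IH ?mulr0 ?addr0 //; lia.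
Qed.
Lemma qfactS n : qfact n.+1 = qfact n * (1 - y ^+ n.+1).
Proof. by rewrite /qfact big_ord_recr. Qed.

Lemma gbin_qfact m j : gbin (m + j) j * qfact j * qfact m = qfact (m + j).
Proof.
move E: (m + j)%N => n; elim: n m j E => [|n IH] [|m] [|j] // E.
- by rewrite /qfact !big_ord0 !mulr1.
- have En : (0 + j = n)%N by lia.
  have H : qfact 0 = 1 by rewrite /qfact big_ord0.
  have := IH 0%N j En; rewrite gbinS [gbin n j.+1]gbin_small; last by lia.
  by rewrite mulr0 addr0 !qfactS H !mulr1 => IHj; rewrite mulrA IHj -En.
- by rewrite gbin0 mul1r {1}/qfact big_ord0 mul1r; congr qfact; lia.
have /IH IH1 : (m.+1 + j = n)%N by lia.
have /IH IH2 : (m + j.+1 = n)%N by lia.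
rewrite gbinS qfactS.
(* The last factor 1 - y^(n+1) is split along n + 1 = (j + 1) + (m + 1), one piece for each
   induction hypothesis. *)
rewrite [RHS](_ : _ = (1 - y ^+ j.+1) * qfact n + y ^+ j.+1 * (1 - y ^+ m.+1) * qfact n).
  by rewrite -{1}IH1 -IH2 !qfactS; ring.
rewrite qfactS -E exprD; ring.
Qed.

(** Induction peels off the factor k = 0 and replaces [t] by [t * y]. The second variable [s] lets
    the triple product avoid negative powers of q. *)
Lemma gbin_theorem n s t :
  \prod_(k < n) (s + t * y ^+ k) =
  \sum_(j < n.+1) y ^+ 'C(j, 2) * gbin n j * t ^+ j * s ^+ (n - j).
Proof.
elim: n t => [|n IH] t.
  by rewrite big_ord0 big_ord1 gbin0 !expr0 !mulr1.
rewrite big_ord_recl /= expr0 mulr1.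
rewrite (eq_bigr (fun k : 'I_n => s + t * y * y ^+ k)); last first.
  by move=> k _; rewrite /bump /= add1n exprS mulrA.
rewrite IH mulrDl.
have -> : s * (\sum_(j < n.+1) y ^+ 'C(j, 2) * gbin n j * (t * y) ^+ j * s ^+ (n - j))
   = \sum_(j < n.+2) y ^+ ('C(j, 2) + j) * gbin n j * t ^+ j * s ^+ (n.+1 - j).
  rewrite [RHS]big_ord_recr /= gbin_small // mulr0 !mul0r addr0 mulr_sumr.
  apply: eq_bigr => j _; rewrite subSn; last by have := ltn_ord j; lia.
  by rewrite exprMn exprS exprD; ring.
rewrite [X in X + _]big_ord_recl [RHS]big_ord_recl /= !expr0 !gbin0 subn0 -addrA.
congr (_ + _).
rewrite mulr_sumr -big_split /=; apply: eq_bigr => j _.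
rewrite /bump /= !add1n gbinS subSS binS bin1 exprMn !exprD exprS.
by rewrite [t ^+ _.+1]exprS; ring.
Qed.

End GaussBinomial.

Lemma bin2D m n : 'C(m + n, 2) = ('C(m, 2) + 'C(n, 2) + m * n)%N.
Proof.
elim: m => [|m IH]; first by rewrite !add0n mul0n addn0.
by rewrite addSn !binS !bin1 IH; lia.
Qed.
Lemma bin2_double k : (2 * 'C(k, 2) + k = k * k)%N.
Proof. by elim: k => // k IH; rewrite binS bin1; lia. Qed.

Section JacobiTriple.
Variable K : comNzRingType.
Implicit Types f g h : fps K.
Local Notation X := (fX K).

Lemma fXn_inj c f g : X ^+ c * f = X ^+ c * g -> f = g.
Proof.
move=> E; apply: fpsP => n; have := congr1 (fun h => fcoef h (c + n)%N) E.
by rewrite !fcoefXnM leq_addr addKn.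
Qed.

(** The exponent (a+d) i(i-1)/2 + a i at i = j - M, rewritten for negative i so as to stay in
    [nat]. *)
Definition texp a d M j :=
  (if M <= j then (a + d) * 'C(j - M, 2) + a * (j - M)
   else (a + d) * 'C(M - j, 2) + d * (M - j))%N.

Lemma texpE a d M j : (j <= 2 * M)%N ->
  ((a + d) * 'C(j, 2) + a * j + (a + d) * M * (2 * M - j) =
   (a + d) * M * M + a * M + (a + d) * 'C(M, 2) + texp a d M j)%N.
Proof.
move=> jM; rewrite /texp; case: leqP => H.
  have [i E] : exists i, j = (M + i)%N by exists (j - M)%N; lia.
  rewrite E addKn bin2D.
  have -> : (2 * M - (M + i) = M - i)%N by lia.
  have [k Ek] : exists k, M = (i + k)%N by exists (M - i)%N; lia.
  by rewrite Ek addKn; ring.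
have [k E] : exists k, M = (j + k)%N by exists (M - j)%N; lia.
rewrite E addKn bin2D.
have -> : (2 * (j + k) - j = j + 2 * k)%N by lia.
have := bin2_double k; set c := 'C(k, 2) => Ec.
have -> : ((a + d) * 'C(j, 2) + a * j + (a + d) * (j + k) * (j + 2 * k) =
  (a + d) * 'C(j, 2) + a * j + (a + d) * (j * j + 3 * (j * k) + (k * k) + (k * k)))%N by ring.
rewrite -{1}Ec; ring.
Qed.

Lemma prod_fX (n : nat) (F : nat -> nat) :
  \prod_(k < n) X ^+ F k = X ^+ (\sum_(k < n) F k)%N.
Proof. by elim/big_rec2: _ => // i m p _ ->; rewrite exprD. Qed.

(** The Gaussian binomial theorem for 2M factors in base q^(a+d), centred at j = M by the choice of
    [s] and [t]: the lower half of the factors yields those with q^d, the upper half those with q^a,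
    up to a common power of q. *)
Lemma finite_jacobi a d M :
  \prod_(k < M) ((1 - X ^+ (a + (a + d) * k)) * (1 - X ^+ (d + (a + d) * k))) =
  \sum_(j < (2 * M).+1) (-1) ^+ (j + M) * (X ^+ texp a d M j * gbin (X ^+ (a + d)) (2 * M) j).
Proof.
set b := (a + d)%N.
(* The total power of q pulled out of the 2M factors. *)
pose c := (b * M * M + a * M + b * 'C(M, 2))%N.
apply: (@fXn_inj c).
have := gbin_theorem (X ^+ b) (2 * M) (X ^+ (b * M)) (- X ^+ a).
rewrite mul2n -addnn big_split_ord /=.
rewrite [X in X * _ = _](reindex_inj rev_ord_inj) /= -big_split /=.
rewrite (eq_bigr (fun k : 'I_M => (-1) * X ^+ (b * M + a + b * (M - k.+1)) *
   ((1 - X ^+ (a + b * k)) * (1 - X ^+ (d + b * k))))); last first.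
  move=> k _; have kM := ltn_ord k.
  rewrite -!exprM.
  have -> : X ^+ (b * M) + - X ^+ a * X ^+ (b * (M - k.+1)) =
     - X ^+ (a + b * (M - k.+1)) * (1 - X ^+ (d + b * k)).
    rewrite mulrBr mulr1 !mulNr opprK -!exprD addrC.
    by congr (_ + X ^+ _); rewrite /b; nia.
  have -> : X ^+ (b * M) + - X ^+ a * X ^+ (b * (M + k)) =
     X ^+ (b * M) * (1 - X ^+ (a + b * k)).
    rewrite mulrBr mulr1 -exprD mulNr -exprD.
    by congr (_ - X ^+ _); rewrite /b; nia.
  by rewrite !exprD; ring.
rewrite big_split /= [X in X * _ = _]big_split /= prodr_const card_ord.
rewrite (prod_fX M (fun k => b * M + a + b * (M - k.+1))%N).
have -> : (\sum_(k < M) (b * M + a + b * (M - k.+1)) = c)%N.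
  rewrite /c {c}; elim: M => [|M IH]; first by rewrite big_ord0 !muln0.
  rewrite big_ord_recl /= subn1 /= binS bin1.
  rewrite (eq_bigr (fun k : 'I_M => (b * M + a + b * (M - k.+1)) + b)%N); last first.
    by move=> k _; rewrite /bump /= add1n subSS mulnS; lia.
  by rewrite big_split /= IH sum_nat_const card_ord; ring.
move=> E; rewrite mulr_sumr.
transitivity ((-1) ^+ M * ((-1) ^+ M * X ^+ c *
   (\prod_(k < M) ((1 - X ^+ (a + b * k)) * (1 - X ^+ (d + b * k)))))).
  by rewrite !mulrA -exprMn mulrNN mulr1 expr1n mul1r.
rewrite E addnn -mul2n mulr_sumr; apply: eq_bigr => j _.
have jM : (j <= 2 * M)%N by have := ltn_ord j; lia.
rewrite [(- X ^+ a) ^+ _]exprNn -!exprM.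
transitivity ((-1) ^+ (j + M) * (X ^+ (b * 'C(j, 2) + a * j + b * M * (2 * M - j)) *
   gbin (X ^+ b) (2 * M) j)).
  by rewrite !exprD; ring.
by rewrite texpE // -/b -/c [X ^+ (c + _)]exprD; ring.
Qed.

Lemma leq_texp a d M j : (0 < a)%N -> (0 < d)%N ->
  ((if M <= j then j - M else M - j) <= texp a d M j)%N.
Proof. by rewrite /texp; case: ifP => _ a0 d0; nia. Qed.

Lemma qfact_poch b n : (0 < b)%N -> eqm n.+1 (qfact (X ^+ b) n) (poch K b b).
Proof.
move=> b0; apply: eqm_sym; apply: eqm_trans (eqm_iprod (cvf_poch _ _ _)) _ => //.
by apply: eqm_prod => k _; rewrite -exprM mulnS.
Qed.

(** To this precision every [qfact] in [gbin_qfact] agrees with (q^b; q^b)_oo, and one copy of that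
    product cancels. *)
Lemma eqm_gbin_poch b m j : (0 < b)%N ->
  eqm (minn m j).+1 (gbin (X ^+ b) (m + j) j * poch K b b) 1.
Proof.
move=> b0; set N := (minn m j).+1.
have Q n : (N <= n.+1)%N -> eqm N (qfact (X ^+ b) n) (poch K b b).
  by move=> Nn; exact: (eqm_le Nn (@qfact_poch b n b0)).
have E : eqm N (gbin (X ^+ b) (m + j) j * poch K b b * poch K b b) (poch K b b).
  apply: (eqm_trans _ (Q (m + j)%N _)); last by rewrite /N; lia.
  rewrite -gbin_qfact; apply: eqmM; last by apply: eqm_sym; apply: Q; rewrite /N; lia.
  by apply: eqmM => //; apply: eqm_sym; apply: Q; rewrite /N; lia.
have := eqmM E (@eqm_refl _ N (ipoch K b b)).
by rewrite (poch_ipoch K b0 b0) -[_ * ipoch K b b]mulrA (poch_ipoch K b0 b0) mulr1.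
Qed.

(** In [finite_jacobi] the j-th Gaussian binomial is close to its limit only up to degree M - |j -
    M|, but its power of q has exponent at least |j - M|, which makes up for the loss. *)
Lemma jacobi_triple_mod a d M : (0 < a)%N -> (0 < d)%N ->
  eqm M.+1 (poch K a (a + d) * poch K d (a + d) * poch K (a + d) (a + d))
     (\sum_(j < (2 * M).+1) (-1) ^+ (j + M) * X ^+ texp a d M j).
Proof.
move=> a0 d0; have b0 : (0 < a + d)%N by lia.
apply: (@eqm_trans _ _ _ ((\prod_(k < M) ((1 - X ^+ (a + (a + d) * k)) *
   (1 - X ^+ (d + (a + d) * k)))) * poch K (a + d) (a + d))).
  by rewrite big_split /=; do 2!apply: eqmM => //; apply: eqm_iprod; apply: cvf_poch.
rewrite finite_jacobi mulr_suml; apply: eqm_sum => j _.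
rewrite -!mulrA; apply: eqmM => //.
have jM := ltn_ord j.
have -> : gbin (X ^+ (a + d)) (2 * M) j = gbin (X ^+ (a + d)) (2 * M - j + j) j.
  by congr gbin; lia.
have G := @eqm_gbin_poch (a + d) (2 * M - j) j b0.
have := @leq_texp a d M j a0 d0; set t := texp _ _ _ _ => tj.
move=> n nM; rewrite -[X ^+ t in RHS]mulr1 !fcoefXnM; case: ifP => // tn.
apply: G; move: tj; case: ifP => ? ?; lia.
Qed.
End JacobiTriple.

(** * The quintic theta identity *)

Lemma big_supp (T : eqType) (V : nmodType) (s1 s2 : seq T) (F : T -> V) :
  uniq s1 -> uniq s2 -> (forall x, F x != 0 -> (x \in s1) = (x \in s2)) ->
  \sum_(x <- s1) F x = \sum_(x <- s2) F x.
Proof.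
move=> u1 u2 H.
have Z s : \sum_(x <- s) F x = \sum_(x <- [seq x <- s | F x != 0]) F x.
  rewrite (bigID (fun x => F x != 0)) /= [X in _ + X]big1 ?addr0 ?big_filter //.
  by move=> x /negbNE/eqP.
rewrite (Z s1) (Z s2); apply: perm_big; apply: uniq_perm; rewrite ?filter_uniq //.
by move=> x; rewrite !mem_filter; case: (boolP (F x != 0)) => //= /H.
Qed.

Lemma big_iota_ord (V : nmodType) n (F : nat -> V) :
  \sum_(j <- iota 0 n) F j = \sum_(j < n) F j.
Proof. by rewrite -(big_mkord xpredT F) /index_iota subn0. Qed.

Lemma sum_ord5 (V : nmodType) (F : nat -> V) :
  \sum_(r < 5) F r = F 0 + F 1 + F 2 + F 3 + F 4.
Proof. by rewrite -big_iota_ord !big_cons big_nil addr0 !addrA. Qed.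

Definition irange M : seq int := [seq j%:Z - M%:Z | j <- iota 0 (2 * M).+1].

Lemma mem_irange M i : (i \in irange M) = (`|i| <= M)%N.
Proof.
apply/mapP/idP => [[j]|iM]; first by rewrite mem_iota => jM ->; lia.
by exists (absz (i + M%:Z)); rewrite ?mem_iota; lia.
Qed.
Lemma irange_uniq M : uniq (irange M).
Proof. by rewrite map_inj_uniq ?iota_uniq // => i j; lia. Qed.

Definition ibox M : seq (int * int) := [seq (u, s) | u <- irange M, s <- irange M].

Lemma mem_ibox M p : (p \in ibox M) = (`|p.1| <= M)%N && (`|p.2| <= M)%N.
Proof.
rewrite -!mem_irange; case: p => u s; apply/allpairsP/andP => /=.
  by case=> -[u' s'] /= [? ? [-> ->]].
by case=> ? ?; exists (u, s).
Qed.
Lemma ibox_uniq M : uniq (ibox M).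
Proof. by apply: allpairs_uniq; rewrite ?irange_uniq // => -[? ?] [? ?]. Qed.

(** The box itself may fail to be stable under [phi]; only the support of [F] matters. *)
Lemma big_ibox_invol (V : nmodType) M (phi : int * int -> int * int) (F : int * int -> V) :
  involutive phi ->
  (forall p, F p != 0 -> p \in ibox M /\ phi p \in ibox M) ->
  \sum_(p <- ibox M) F (phi p) = \sum_(p <- ibox M) F p.
Proof.
move=> phiK H; rewrite -(big_map phi xpredT F); apply: big_supp.
- by rewrite map_inj_uniq ?ibox_uniq //; apply: inv_inj.
- exact: ibox_uniq.
move=> p /H[p1 p2]; rewrite p1; apply/mapP.
by exists (phi p); rewrite ?phiK.
Qed.

(* The exponents of the theta series of [(q,q^4,q^5;q^5)] and [(q^2,q^3,q^5;q^5)]. *)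
Definition theta1_exp (i : int) : nat := (absz (5 * i * i - 3 * i)%R %/ 2)%N.
Definition theta2_exp (i : int) : nat := (absz (5 * i * i - i)%R %/ 2)%N.

Lemma int_parity (i : int) : exists k, i = 2 * k \/ i = 2 * k + 1.
Proof. exists (i %/ 2)%Z; lia. Qed.

Lemma theta1_expE i : 2 * (theta1_exp i)%:Z = 5 * i * i - 3 * i.
Proof.
rewrite /theta1_exp; have : 0 <= 5 * i * i - 3 * i by nia.
have [k E] := int_parity i.
have [m ->] : exists m, 5 * i * i - 3 * i = 2 * m; last by lia.
by case: E => ->; [exists (10 * k * k - 3 * k)|exists (10 * k * k + 7 * k + 1)]; ring.
Qed.
Lemma theta2_expE i : 2 * (theta2_exp i)%:Z = 5 * i * i - i.
Proof.
rewrite /theta2_exp; have : 0 <= 5 * i * i - i by nia.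
have [k E] := int_parity i.
have [m ->] : exists m, 5 * i * i - i = 2 * m; last by lia.
by case: E => ->; [exists (10 * k * k - k)|exists (10 * k * k + 9 * k + 2)]; ring.
Qed.
Lemma nat_eq_double5 (a b c u v : nat) :
  2 * a%:Z + 2 * b%:Z = 2 * c%:Z + 5 * (2 * u%:Z) + 5 * (2 * v%:Z) ->
  (a + b = c + 5 * u + 5 * v)%N.
Proof. lia. Qed.
Lemma nat_eq_double (a b c d : nat) :
  2 * a%:Z + 2 * b%:Z = 2 * c%:Z + 2 * d%:Z -> (a + b = c + d)%N.
Proof. lia. Qed.
Lemma theta1_exp_ge i : (`|i| <= theta1_exp i)%N.
Proof. by have := theta1_expE i; nia. Qed.
Lemma theta2_exp_ge i : (`|i| <= theta2_exp i)%N.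
Proof. by have := theta2_expE i; nia. Qed.

Section QuinticTheta.
Variable K : numDomainType.
Local Notation X := (fX K).
Local Notation "'P_' a" := (poch K a 5) (at level 2, a at level 1).

Definition sgi (i : int) : fps K := (-1) ^+ `|i|%N.

Lemma sgiM i j : sgi i * sgi j = sgi (i + j).
Proof.
rewrite /sgi -exprD -[LHS]signr_odd -[RHS]signr_odd; congr (_ ^+ nat_of_bool _).
lia.
Qed.

Definition theta1 := P_ 1 * P_ 4 * P_ 5.
Definition theta2 := P_ 2 * P_ 3 * P_ 5.
Definition ftheta (p : int -> nat) M := \sum_(i <- irange M) sgi i * X ^+ p i.

Lemma texp_fth a d p M :
  (forall i : int, 2 * (p i)%:Z = (a + d)%:Z * i * i - (d%:Z - a%:Z) * i) ->
  \sum_(j < (2 * M).+1) (-1) ^+ (j + M) * X ^+ texp a d M j = ftheta p M.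
Proof.
move=> pE; rewrite /ftheta big_map big_iota_ord.
apply: eq_bigr => -[j /= _] _; congr (_ * X ^+ _).
  rewrite /sgi -[LHS]signr_odd -[RHS]signr_odd; congr (_ ^+ nat_of_bool _); lia.
have := pE (j%:Z - M%:Z); rewrite /texp; case: leqP => H E.
  have [i Ei] : exists i, j = (M + i)%N by exists (j - M)%N; lia.
  rewrite Ei in E *; rewrite addKn.
  by have := bin2_double i; lia.
have [i Ei] : exists i, M = (j + i)%N by exists (M - j)%N; lia.
rewrite Ei addKn in E *.
by have := bin2_double i; lia.
Qed.

Lemma theta1_mod M : eqm M.+1 theta1 (ftheta theta1_exp M).
Proof.
rewrite -(@texp_fth 1 4); last by move=> i; rewrite theta1_expE; lia.
exact: (@jacobi_triple_mod K 1 4).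
Qed.
Lemma theta2_mod M : eqm M.+1 theta2 (ftheta theta2_exp M).
Proof.
rewrite -(@texp_fth 2 3); last by move=> i; rewrite theta2_expE; lia.
exact: (@jacobi_triple_mod K 2 3).
Qed.

Lemma sub5_fth p M : sub5 (ftheta p M) = \sum_(i <- irange M) sgi i * X ^+ (5 * p i).
Proof.
rewrite rmorph_sum /=; apply: eq_bigr => i _.
by rewrite rmorphM rmorph_sign rmorphXn /= sub5X -exprM.
Qed.

Lemma fth_prod c p p' M :
  X ^+ c * ((\sum_(i <- irange M) sgi i * X ^+ p i) * (\sum_(i <- irange M) sgi i * X ^+ p' i)) =
  \sum_(x <- ibox M) sgi (x.1 + x.2) * X ^+ (c + p x.1 + p' x.2).
Proof.
rewrite /ibox big_allpairs /= mulr_suml mulr_sumr; apply: eq_bigr => i _.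
rewrite mulr_sumr mulr_sumr; apply: eq_bigr => j _.
by rewrite -sgiM !exprD; ring.
Qed.

Lemma fcoef_sgi i f n : fcoef (sgi i * f) n = (-1) ^+ `|i|%N * fcoef f n.
Proof.
rewrite /sgi; elim: absz => [|k IH]; first by rewrite !mul1r.
by rewrite !exprS -!mulrA !mulN1r fcoefN IH.
Qed.

Lemma fcoef_box c p p' M l :
  fcoef (X ^+ c * ((\sum_(i <- irange M) sgi i * X ^+ p i) * (\sum_(i <- irange M) sgi i * X ^+ p' i))) l =
  \sum_(x <- ibox M) (-1) ^+ absz (x.1 + x.2) * (l == c + p x.1 + p' x.2)%N%:R.
Proof.
by rewrite fth_prod fcoef_sum; apply: eq_bigr => x _; rewrite fcoef_sgi fcoefXn.
Qed.

Section Coefficient.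
Variable l : nat.
(** Large enough for all box sums below: [rot_support] puts the relevant points within 3l + 2, and
    the reflections used later move them by at most 3. *)
Let M := (3 * l + 10)%N.
Let W (x : int * int) : K := (-1) ^+ absz (x.1 + x.2) * (l == theta1_exp x.1 + theta2_exp x.2)%N%:R.
(* Multiplication by a Gaussian integer of norm 5, on each of the five cosets
   of its image. *)
Let rot (r : nat) (x : int * int) := (x.1 + 2 * x.2, 2 * x.1 - x.2 + r%:Z).

Lemma W_neq0 x : W x != 0 -> l = (theta1_exp x.1 + theta2_exp x.2)%N.
Proof. by rewrite /W; case: (l =P _) => // _; rewrite mulr0 eqxx. Qed.

(** The five images partition the lattice, since (m, n) lies in the r-th one exactly when n - 2m is
    congruent to r modulo 5. *)
Lemma sum_W_cosets :
  \sum_(x <- ibox M) W x = \sum_(r < 5) \sum_(x <- ibox M) W (rot r x).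
Proof.
pose phi (z : nat * (int * int)) := rot z.1 z.2.
have -> : \sum_(r < 5) \sum_(x <- ibox M) W (rot r x) =
   \sum_(z <- [seq phi (r, x) | r <- iota 0 5, x <- ibox M]) W z.
  by rewrite big_allpairs_dep big_iota_ord.
apply: big_supp; first exact: ibox_uniq.
  rewrite allpairs_uniq ?iota_uniq ?ibox_uniq //.
  move=> [r [u s]] [r' [u' s']] A1 A2; rewrite /phi /rot /= => -[E1 E2].
  have {A1} : r \in iota 0 5 by case/allpairsP: A1 => -[r1 x1] /= [H1 _ [-> _]].
  have {A2} : r' \in iota 0 5 by case/allpairsP: A2 => -[r1 x1] /= [H1 _ [-> _]].
  rewrite !mem_iota => H1 H2; have Er : r = r' by lia.
  by rewrite Er; congr (_, (_, _)); lia.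
move=> [m n] /W_neq0 /= E; have := theta1_exp_ge m; have := theta2_exp_ge n => Hn Hm.
rewrite mem_ibox /= (_ : (_ <= _)%N && _ = true); last by rewrite /M; lia.
apply: esym; change (is_true ((m, n) \in [seq phi (r, x) | r <- iota 0 5, x <- ibox M])).
apply/allpairsP.
(* Solves (m, n) = [rot r (u, s)]: n - 2m = r - 5s fixes r and s, and then u = m - 2s. *)
pose r := absz ((n - 2 * m) %% 5)%Z; pose s := ((2 * m - n + r%:Z) %/ 5)%Z.
exists (r, (m - 2 * s, s)); split; rewrite ?mem_iota ?mem_ibox /phi /rot.
- by rewrite -[(r, _).1]/r /r; lia.
- by rewrite /= /s /r /M; lia.
by congr (_, _); rewrite /= /s /r; lia.
Qed.

Lemma fcoef_theta12 N : (l <= N)%N ->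
  fcoef (theta1 * theta2) l =
  \sum_(x <- ibox N) W x.
Proof.
move=> lN; have H := eqmM (@theta1_mod N) (@theta2_mod N).
rewrite H; last by lia.
by have := @fcoef_box 0 theta1_exp theta2_exp N l; rewrite expr0 mul1r.
Qed.

Lemma fcoef_sub5_theta c p p' t t' : (forall N, eqm N.+1 t (ftheta p N)) ->
  (forall N, eqm N.+1 t' (ftheta p' N)) ->
  fcoef (X ^+ c * sub5 (t * t')) l =
  \sum_(x <- ibox M) (-1) ^+ absz (x.1 + x.2) * (l == c + 5 * p x.1 + 5 * p' x.2)%N%:R.
Proof.
move=> H H'; rewrite sub5M.
have := eqmM (@eqm_refl _ M.+1 (X ^+ c)) (eqmM (eqm_sub5 (H M)) (eqm_sub5 (H' M))).
move=> ->; last by rewrite /M; lia.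
by rewrite !sub5_fth (fcoef_box c (fun i => 5 * p i)%N (fun i => 5 * p' i)%N).
Qed.

Lemma rot_support r x : (r < 5)%N -> W (rot r x) != 0 ->
  (absz x.1 <= 3 * l + 2)%N && (absz x.2 <= l + 1)%N.
Proof.
move=> r5 /W_neq0 /= E; move: (theta1_exp_ge (x.1 + 2 * x.2)) (theta2_exp_ge (2 * x.1 - x.2 + r%:Z)).
lia.
Qed.

Lemma rot_invol r phi : (r < 5)%N -> involutive phi ->
  (forall x, absz (phi x).1 <= absz x.1 + 3 /\ absz (phi x).2 <= absz x.2 + 3)%N ->
  \sum_(x <- ibox M) W (rot r x) = \sum_(x <- ibox M) W (rot r (phi x)).
Proof.
move=> r5 phiK H; apply/esym/(big_ibox_invol (F := fun x => W (rot r x)) phiK).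
move=> p /(rot_support r5) /andP[h1 h2]; have [h3 h4] := H p.
rewrite !mem_ibox /M; split; apply/andP; split.
- by apply: leq_trans h1 _; lia.
- by apply: leq_trans h2 _; lia.
- by apply: leq_trans h3 (leq_trans (leq_add h1 (leqnn 3)) _); lia.
- by apply: leq_trans h4 (leq_trans (leq_add h2 (leqnn 3)) _); lia.
Qed.

(** The sum equals its own negative, and 2 is not a zero divisor in a [numDomainType]. *)
Lemma rot_antisym r phi : (r < 5)%N -> involutive phi ->
  (forall x, absz (phi x).1 <= absz x.1 + 3 /\ absz (phi x).2 <= absz x.2 + 3)%N ->
  (forall x, W (rot r (phi x)) = - W (rot r x)) ->
  \sum_(x <- ibox M) W (rot r x) = 0.
Proof.
move=> r5 phiK H E; have := rot_invol r5 phiK H.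
rewrite [RHS](eq_bigr (fun x => - W (rot r x))) // sumrN => /eqP.
by rewrite -addr_eq0 -mulr2n mulrn_eq0 /= => /eqP.
Qed.

(** [rot] multiplies u^2 + s^2 by 5 without a cross term, so on each coset the exponent separates
    into a quadratic in u and one in s. For r = 0, 1, 3 these are 5 times theta exponents plus a
    constant, after a reflection when r is 1 or 3. *)
Lemma rot0 : \sum_(x <- ibox M) W (rot 0 x) = fcoef (sub5 (theta2 * theta2)) l.
Proof.
have := @fcoef_sub5_theta 0 theta2_exp theta2_exp _ _ (@theta2_mod) (@theta2_mod).
rewrite expr0 mul1r => ->; apply: eq_bigr => -[u s] _; rewrite /W /rot /=.
rewrite -signr_odd -[in RHS]signr_odd; congr (_ ^+ nat_of_bool _ * _%:R); first lia.
congr (nat_of_bool (l == _)); apply: nat_eq_double5; rewrite !theta1_expE !theta2_expE; ring.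
Qed.

Lemma rot1 : \sum_(x <- ibox M) W (rot 1 x) = - fcoef (X ^+ 2 * sub5 (theta1 * theta1)) l.
Proof.
have := @fcoef_sub5_theta 2 theta1_exp theta1_exp _ _ (@theta1_mod) (@theta1_mod).
(* Twice the exponent is 25u^2 + 15u + 25s^2 - 15s + 4; flipping u gives two copies of
   [theta1_exp]. *)
move=> ->; rewrite -sumrN (@rot_invol _ (fun x => (- x.1, x.2))) //; last 2 first.
- by case=> u s; rewrite /= opprK.
- by case=> u s /=; lia.
apply: eq_bigr => -[u s] _; rewrite /W /rot /= -[RHS]mulN1r mulrA -exprS.
rewrite -signr_odd -[in RHS]signr_odd; congr (_ ^+ nat_of_bool _ * _%:R); first lia.
congr (nat_of_bool (l == _)); apply: nat_eq_double5; rewrite !theta1_expE !theta2_expE; ring.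
Qed.

Lemma rot3 : \sum_(x <- ibox M) W (rot 3 x) = - fcoef (X ^+ 1 * sub5 (theta2 * theta1)) l.
Proof.
have := @fcoef_sub5_theta 1 theta2_exp theta1_exp _ _ (@theta2_mod) (@theta1_mod).
(* Twice the exponent is 25u^2 + 55u + 25s^2 - 35s + 42, which this reflection turns into 5(5u^2 -
   u) + 5(5s^2 - 3s) + 2. *)
move=> ->; rewrite -sumrN (@rot_invol _ (fun x => (-1 - x.1, 1 - x.2))) //; last 2 first.
- by case=> u s /=; congr (_, _); lia.
- by case=> u s /=; lia.
apply: eq_bigr => -[u s] _; rewrite /W /rot /= -[RHS]mulN1r mulrA -exprS.
rewrite -signr_odd -[in RHS]signr_odd; congr (_ ^+ nat_of_bool _ * _%:R); first lia.
congr (nat_of_bool (l == _)); apply: nat_eq_double5; rewrite !theta1_expE !theta2_expE; ring.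
Qed.

(** Here s enters the exponent through s^2 - s only; s -> 1 - s preserves it and flips the sign. *)
Lemma rot2 : \sum_(x <- ibox M) W (rot 2 x) = 0.
Proof.
apply: (@rot_antisym _ (fun x => (x.1, 1 - x.2))) => //.
- by case=> u s /=; congr (_, _); lia.
- by case=> u s /=; lia.
case=> u s; rewrite /W /rot /= -[RHS]mulN1r mulrA -exprS.
rewrite -signr_odd -[in RHS]signr_odd; congr (_ ^+ nat_of_bool _ * _%:R); first lia.
congr (nat_of_bool (l == _)); apply: nat_eq_double; rewrite !theta1_expE !theta2_expE; ring.
Qed.

(** Here u enters the exponent through u^2 + 3u only; u -> -3 - u preserves it and flips the
    sign. *)
Lemma rot4 : \sum_(x <- ibox M) W (rot 4 x) = 0.
Proof.
apply: (@rot_antisym _ (fun x => (-3 - x.1, x.2))) => //.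
- by case=> u s /=; congr (_, _); lia.
- by case=> u s /=; lia.
case=> u s; rewrite /W /rot /= -[RHS]mulN1r mulrA -exprS.
rewrite -signr_odd -[in RHS]signr_odd; congr (_ ^+ nat_of_bool _ * _%:R); first lia.
congr (nat_of_bool (l == _)); apply: nat_eq_double; rewrite !theta1_expE !theta2_expE; ring.
Qed.

Lemma fcoef_theta_dissection :
  fcoef (theta1 * theta2) l = fcoef (sub5 (theta2 * theta2) - X * sub5 (theta1 * theta2)
                    - X ^+ 2 * sub5 (theta1 * theta1)) l.
Proof.
rewrite (@fcoef_theta12 M) /M ?fcoefB; last by lia.
rewrite sum_W_cosets (sum_ord5 (fun r => \sum_(x <- ibox M) W (rot r x))).
rewrite rot0 rot1 rot2 rot3 rot4 expr1 !addr0 [theta2 * theta1]mulrC.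
by rewrite addrAC.
Qed.

End Coefficient.

Lemma theta_dissection :
  theta1 * theta2 = sub5 (theta2 * theta2) - X * sub5 (theta1 * theta2)
                    - X ^+ 2 * sub5 (theta1 * theta1).
Proof. by apply: fpsP => l; apply: fcoef_theta_dissection. Qed.
End QuinticTheta.

(** * The quintic relation between f(q) and f(q^5) *)

Section FifthRoots.
Variable A : comNzRingType.

Lemma prod_fifth_roots (z x : A) : 1 + z + z ^+ 2 + z ^+ 3 + z ^+ 4 = 0 ->
  (1 - x) * (1 - z * x) * (1 - z ^+ 2 * x) * (1 - z ^+ 3 * x) * (1 - z ^+ 4 * x) = 1 - x ^+ 5.
Proof.
move=> H; have z4 : z ^+ 4 = - 1 - z - z ^+ 2 - z ^+ 3.
  by apply/eqP; rewrite -subr_eq0 -H; apply/eqP; ring.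
ring: z4.
Qed.

(** [a], [b], [c] stand for the parts of a series with exponents 0, 1, 2 modulo 5, whence the
    twists. The claim is a polynomial identity modulo the fifth cyclotomic polynomial. *)
Lemma norm_fifth_roots (z a b c : A) : 1 + z + z ^+ 2 + z ^+ 3 + z ^+ 4 = 0 ->
  (a - b - c) * (a - z * b - z ^+ 2 * c) * (a - z ^+ 2 * b - (z ^+ 2) ^+ 2 * c) *
  (a - z ^+ 3 * b - (z ^+ 3) ^+ 2 * c) * (a - z ^+ 4 * b - (z ^+ 4) ^+ 2 * c) =
  a ^+ 5 - b ^+ 5 - c ^+ 5 - 5 * (a * b ^+ 3 * c) - 5 * (a ^+ 2 * b * c ^+ 2).
Proof.
move=> H; have z4 : z ^+ 4 = - 1 - z - z ^+ 2 - z ^+ 3.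
  by apply/eqP; rewrite -subr_eq0 -H; apply/eqP; ring.
ring: z4.
Qed.
End FifthRoots.

Section RogersRamanujan.
Variable K : numClosedFieldType.
Local Notation X := (fX K).
Local Notation "'P_' a" := (poch K a 5) (at level 2, a at level 1).
Local Notation "'I_' a" := (ipoch K a 5) (at level 2, a at level 1).

Lemma fifth_root_exists : exists z : K, 1 + z + z ^+ 2 + z ^+ 3 + z ^+ 4 = 0.
Proof.
have /closed_rootP[z] : size (1 + 'X + 'X^2 + 'X^3 + 'X^4 : {poly K}) != 1%N.
  rewrite addrC size_polyDl ?size_polyXn //.
  rewrite addrC size_polyDl ?size_polyXn // addrC size_polyDl ?size_polyXn //.
  by rewrite addrC size_polyDl ?size_polyX ?size_poly1.
by rewrite rootE !hornerE => /eqP; exists z.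
Qed.

Definition euler1 := P_ 1 * P_ 2 * P_ 3 * P_ 4 * P_ 5.
(* The series called f, g and e = E_5/E_1 above. *)
Definition rrf := P_ 1 * P_ 4 * I_ 2 * I_ 3.
Definition rrg := P_ 2 * P_ 3 * I_ 1 * I_ 4.
Definition reg5 := I_ 1 * I_ 2 * I_ 3 * I_ 4.

Lemma poch_ipoch5 a : (0 < a)%N -> P_ a * I_ a = 1.
Proof. by move=> a0; apply: poch_ipoch. Qed.

Lemma rrf_rrg : rrf * rrg = 1.
Proof.
rewrite (_ : _ * _ = (P_ 1 * I_ 1) * (P_ 2 * I_ 2) * (P_ 3 * I_ 3) * (P_ 4 * I_ 4)).
  by rewrite !poch_ipoch5 // !mulr1.
rewrite /rrf /rrg; ring.
Qed.

Lemma sub5_exp (f : fps K) n : sub5 (f ^+ n) = sub5 f ^+ n.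
Proof. exact: (rmorphXn (@sub5 K)). Qed.
Lemma sub5_nat n : sub5 n%:R = n%:R :> fps K.
Proof. exact: (rmorph_nat (@sub5 K)). Qed.

Lemma sub5_euler1 : sub5 euler1 = P_ 5.
Proof. by rewrite (@poch_split5 K 5) // !sub5M !sub5_poch. Qed.

Lemma poch_neq0 a b : fcoef (poch K a b) 0 != 0.
Proof. by rewrite poch_0 oner_eq0. Qed.

Local Notation F := (sub5 rrf).
Local Notation G := (sub5 rrg).

Lemma sub5_rrg_rrf : G * F = 1.
Proof. by rewrite -sub5M mulrC rrf_rrg sub5_1. Qed.

Lemma theta12 : theta1 K * theta2 K = euler1 * P_ 5.
Proof. rewrite /theta1 /theta2 /euler1; ring. Qed.

(** This is [theta_dissection] divided by E_5: the squares of [theta2] and [theta1] are g and f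
    times [theta1 * theta2], which is E_1 E_5. *)
Lemma euler1_dissection : euler1 = sub5 P_ 5 * (G - X - X ^+ 2 * F).
Proof.
apply: (@fps_mulI _ P_ 5); first exact: poch_neq0.
rewrite mulrC -theta12 theta_dissection.
have -> : theta2 K * theta2 K = rrg * (theta1 K * theta2 K).
  rewrite /theta1 /theta2 /rrg.
  rewrite [RHS](_ : _ = P_ 1 * I_ 1 * (P_ 4 * I_ 4) * (P_ 2 * P_ 3 * P_ 5 * (P_ 2 * P_ 3 * P_ 5))).
    by rewrite !poch_ipoch5 // !mul1r.
  ring.
have -> : theta1 K * theta1 K = rrf * (theta1 K * theta2 K).
  rewrite /theta1 /theta2 /rrf.
  rewrite [RHS](_ : _ = P_ 2 * I_ 2 * (P_ 3 * I_ 3) * (P_ 1 * P_ 4 * P_ 5 * (P_ 1 * P_ 4 * P_ 5))).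
    by rewrite !poch_ipoch5 // !mul1r.
  ring.
rewrite theta12 (sub5M rrg) (sub5M rrf) (sub5M euler1) sub5_euler1; ring.
Qed.

Section Norm.
Variable z : K.
Hypothesis hz : 1 + z + z ^+ 2 + z ^+ 3 + z ^+ 4 = 0.
Let Z : fps K := fps_const z.

Lemma fifth_root_exp5 : z ^+ 5 = 1.
Proof.
have z4 : z ^+ 4 = - 1 - z - z ^+ 2 - z ^+ 3.
  by apply/eqP; rewrite -subr_eq0 -hz; apply/eqP; ring.
ring: z4.
Qed.

Lemma fifth_root_pow r k : (r %% 5 != 0)%N -> let w := z ^+ (r + 5 * k) in
  1 + w + w ^+ 2 + w ^+ 3 + w ^+ 4 = 0.
Proof.
move=> r5 w.
have {w} -> : w = z ^+ (r %% 5).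
  rewrite /w {1}(divn_eq r 5) -addnA exprD mulnC exprM fifth_root_exp5 expr1n mul1r.
  by rewrite exprD exprM fifth_root_exp5 expr1n mulr1.
have z4 : z ^+ 4 = - 1 - z - z ^+ 2 - z ^+ 3.
  by apply/eqP; rewrite -subr_eq0 -hz; apply/eqP; ring.
move: r5 (ltn_pmod r (ltn0Sn 4)); case: (r %% 5)%N => [|[|[|[|[|?]]]]] // _ _; ring: z4.
Qed.

(** The norm from series in q down to series in q^5. *)
Definition fnorm (f : fps K) :=
  f * dil z f * dil (z ^+ 2) f * dil (z ^+ 3) f * dil (z ^+ 4) f.

Lemma fnormM f g : fnorm (f * g) = fnorm f * fnorm g.
Proof. rewrite /fnorm !dilM; ring. Qed.

Lemma fnorm_sub5 f : fnorm (sub5 f) = sub5 f ^+ 5.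
Proof.
rewrite /fnorm !dil_sub5 ?fifth_root_exp5 //; first by ring.
all: by rewrite -exprM mulnC exprM fifth_root_exp5 expr1n.
Qed.

Lemma dil_Xn w n : dil w (X ^+ n) = fps_const (w ^+ n) * X ^+ n.
Proof. by rewrite !rmorphXn /= dilX exprMn. Qed.

Lemma sub5Xn n : sub5 (X ^+ n) = X ^+ (5 * n).
Proof. by rewrite (rmorphXn (@sub5 K)) /= sub5X -exprM. Qed.

Lemma eqm_fnorm N f g : eqm N f g -> eqm N (fnorm f) (fnorm g).
Proof. by move=> H; do !apply: eqmM => //; apply: eqm_dil. Qed.

(** For m prime to 5 the powers of z^m run over all fifth roots of unity, so each factor 1 - q^m has
    norm 1 - q^(5m). *)
Lemma fnorm_poch r : (r %% 5 != 0)%N -> fnorm P_ r = sub5 P_ r.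
Proof.
move=> r5; have r0 : (0 < r)%N by case: r r5.
apply: eqmP => N; apply: (@eqm_le _ _ N.+1) => //.
have cv := cvf_poch K r0 (ltn0Sn 4).
apply: eqm_trans (eqm_fnorm (eqm_iprod cv)) _.
apply: (eqm_trans _ (eqm_sub5 (eqm_sym (eqm_iprod cv)))).
have -> : fnorm (\prod_(k < N) (1 - X ^+ (r + 5 * k))) =
          \prod_(k < N) fnorm (1 - X ^+ (r + 5 * k)).
  elim: (index_enum _) => [|k s IH]; last by rewrite !big_cons fnormM IH.
  by rewrite !big_nil /fnorm !dil_1 !mulr1.
rewrite rmorph_prod /=; apply: eqm_prod => k _.
have := fifth_root_pow k r5; set m := (r + 5 * k)%N => /= Hw.
have HC : 1 + fps_const (z ^+ m) + fps_const (z ^+ m) ^+ 2 + fps_const (z ^+ m) ^+ 3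
          + fps_const (z ^+ m) ^+ 4 = 0.
  by rewrite -[RHS](rmorph0 (@fps_const K)) -Hw !rmorphD !rmorphXn rmorph1.
have := prod_fifth_roots (X ^+ m) HC; rewrite -!rmorphXn.
rewrite /fnorm !dilB !dil_1 sub5B sub5_1 !dil_Xn sub5Xn -!exprM => E.
by rewrite (mulnC 5) -E !(mulnC m).
Qed.

(** The norm of [euler1_dissection]. The left side becomes E_5^6 / E_25; on the right G F = 1 merges
    the three multiples of q^5, with coefficients 1, 5 and 5, into 11 q^5. *)
Lemma euler5_pow : P_ 5 ^+ 6 = sub5 P_ 5 ^+ 6 * (G ^+ 5 - 11 * X ^+ 5 - X ^+ 10 * F ^+ 5).
Proof.
have N1 : fnorm euler1 * sub5 P_ 5 = P_ 5 ^+ 6.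
  have N5 : fnorm P_ 5 = P_ 5 ^+ 5 by rewrite -sub5_euler1 fnorm_sub5.
  rewrite /euler1 !fnormM N5 !(@fnorm_poch 1, @fnorm_poch 2, @fnorm_poch 3, @fnorm_poch 4) //.
  by rewrite mulrAC -!sub5M -/euler1 sub5_euler1 -exprS.
have Nd w : w ^+ 5 = 1 -> dil w (G - X - X ^+ 2 * F) =
    G - fps_const w * X - fps_const w ^+ 2 * (X ^+ 2 * F).
  move=> w5; rewrite !dilB dilM !dil_sub5 // dil_Xn dilX rmorphXn.
  by rewrite mulrA.
have zk k : (z ^+ k) ^+ 5 = 1 by rewrite -exprM mulnC exprM fifth_root_exp5 expr1n.
have HC : 1 + Z + Z ^+ 2 + Z ^+ 3 + Z ^+ 4 = 0.
  by rewrite -[RHS](rmorph0 (@fps_const K)) -hz !rmorphD !rmorphXn rmorph1.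
rewrite -N1 {1}euler1_dissection fnormM fnorm_sub5 /fnorm.
rewrite (Nd z fifth_root_exp5) !Nd ?zk // !(rmorphXn (@fps_const K)) -/Z.
rewrite (norm_fifth_roots G X (X ^+ 2 * F) HC).
have gf := sub5_rrg_rrf.
rewrite (_ : G * X ^+ 3 * (X ^+ 2 * F) = G * F * X ^+ 5); last by ring.
rewrite (_ : G ^+ 2 * X * (X ^+ 2 * F) ^+ 2 = (G * F) ^+ 2 * X ^+ 5); last by ring.
rewrite gf; ring.
Qed.
End Norm.

(** Equal to (E_1/E_5)^6, by [euler1_pow]. *)
Definition rrw := rrg ^+ 5 - 11 * X - X ^+ 2 * rrf ^+ 5.

Lemma euler1_pow : euler1 ^+ 6 = P_ 5 ^+ 6 * rrw.
Proof.
have [z hz] := fifth_root_exists.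
(* Both sides of [euler5_pow] are series in q^5, so q^5 may be replaced by q. *)
apply: sub5_inj; rewrite sub5M !sub5_exp sub5_euler1 (euler5_pow hz).
congr (_ * _); rewrite /rrw !sub5B (sub5M 11) (sub5M (X ^+ 2)) !sub5_exp sub5X sub5_nat.
by rewrite -exprM.
Qed.

Lemma reg5_pow : reg5 ^+ 6 * rrw = 1.
Proof.
have E : euler1 * reg5 = P_ 5.
  rewrite (_ : euler1 * reg5 = P_ 1 * I_ 1 * (P_ 2 * I_ 2) * (P_ 3 * I_ 3) * (P_ 4 * I_ 4) * P_ 5).
    by rewrite !poch_ipoch5 // !mul1r.
  rewrite /euler1 /reg5; ring.
apply: (@fps_mulI _ (euler1 ^+ 6)).
  by rewrite fcoef0X !fcoef0M !poch_0 !mulr1 expr1n oner_eq0.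
by rewrite mulr1 mulrA -exprMn E euler1_pow.
Qed.

Local Notation v := (X * F).
(** In these polynomials in v, [G * Pv] is E_1/E_25, [Nv / Mv] will be f^5 / f(q^5), and
    [G ^+ 5 * Wv] is (E_5/E_25)^6. *)
Definition Pv := 1 - v - v ^+ 2.
Definition Nv := 1 - 2 * v + 4 * v ^+ 2 - 3 * v ^+ 3 + v ^+ 4.
Definition Mv := 1 + 3 * v + 4 * v ^+ 2 + 2 * v ^+ 3 + v ^+ 4.
Definition Wv := 1 - 11 * v ^+ 5 - v ^+ 10.

Lemma mul_PNM : Pv * Nv * Mv = Wv.
Proof. rewrite /Pv /Nv /Mv /Wv; ring. Qed.

(** This makes [v * Nv / Mv] a root of the quadratic equation that [quintic_key] gives for q f^5. *)
Lemma MN_quadratic : Mv ^+ 2 - 11 * v * Mv * Nv - v ^+ 2 * Nv ^+ 2 = Pv ^+ 5.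
Proof. rewrite /Pv /Nv /Mv; ring. Qed.

Lemma fcoef0_XM f : fcoef (X * f) 0 = 0.
Proof. by rewrite fcoefXM. Qed.

Lemma fcoef_sub5_0 (f : fps K) : fcoef (sub5 f) 0 = fcoef f 0.
Proof. by []. Qed.

Lemma rri_0 : fcoef rrg 0 = 1.
Proof. by rewrite !fcoef0M !poch_0 !ipoch_0 !mulr1. Qed.
Lemma G_0 : fcoef G 0 = 1.
Proof. by rewrite fcoef_sub5_0 rri_0. Qed.

Lemma Pv_0 : fcoef Pv 0 = 1.
Proof. by rewrite /Pv !fcoefB fcoef1 fcoef0X fcoef0_XM expr0n /= !subr0. Qed.
Lemma Mv_0 : fcoef Mv 0 = 1.
Proof.
rewrite /Mv (_ : _ + _ = 1 + X * (3 * F + F * (4 * v + 2 * v ^+ 2 + v ^+ 3))); last by ring.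
by rewrite fcoefD fcoef0_XM fcoef1 addr0.
Qed.

(** E_1^6 is computed twice: as the sixth power of E_25 [G * Pv], and from the norm identity used at
    q and at q^5. *)
Lemma quintic_key : G * Pv ^+ 5 = Nv * Mv * rrw.
Proof.
apply: (@fps_mulI _ (sub5 P_ 5 ^+ 6 * G ^+ 5 * Pv)).
  rewrite (fcoef0M (_ * _)) (fcoef0M (_ ^+ 6)) !fcoef0X G_0 Pv_0 fcoef_sub5_0 poch_0.
  by rewrite !expr1n !mulr1 oner_eq0.
have [z hz] := fifth_root_exists.
transitivity (euler1 ^+ 6).
  rewrite euler1_dissection.
  have -> : G - X - X ^+ 2 * F = G * Pv.
    rewrite /Pv (_ : G * _ = G - X * (G * F) - X ^+ 2 * (G * F) * F); last by ring.
    by rewrite sub5_rrg_rrf !mulr1.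
  ring.
rewrite euler1_pow (euler5_pow hz).
have -> : G ^+ 5 - 11 * X ^+ 5 - X ^+ 10 * F ^+ 5 = G ^+ 5 * (Pv * Nv * Mv).
  rewrite mul_PNM /Wv (_ : G ^+ 5 * _ = G ^+ 5 - 11 * (G * F) ^+ 5 * X ^+ 5
     - (G * F) ^+ 5 * X ^+ 10 * F ^+ 5); last by ring.
  by rewrite sub5_rrg_rrf !expr1n; ring.
ring.
Qed.

Lemma rr_pow5 : Mv * rrf ^+ 5 = F * Nv.
Proof.
(* With [MN_quadratic], [quintic_key] times f^5 factors as (G Mv + q^2 Nv f^5)(Mv f^5 - F Nv) = 0,
   and the first factor has constant term 1. *)
apply/subr0_eq/(@fps_lreg _ (G * Mv + X ^+ 2 * Nv * rrf ^+ 5)).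
  rewrite fcoefD (fcoef0M G) G_0 Mv_0 exprS -!mulrA fcoef0_XM addr0 mulr1.
  exact: oner_neq0.
have gf := sub5_rrg_rrf.
have y : rrg ^+ 5 * rrf ^+ 5 = 1 by rewrite -exprMn mulrC rrf_rrg expr1n.
have := quintic_key; rewrite -MN_quadratic /rrw => E.
transitivity ((G * (Mv ^+ 2 - 11 * v * Mv * Nv - v ^+ 2 * Nv ^+ 2)) * rrf ^+ 5
  - (Nv * Mv * (rrg ^+ 5 - 11 * X - X ^+ 2 * rrf ^+ 5)) * rrf ^+ 5); last by rewrite E subrr.
transitivity (G * Mv ^+ 2 * rrf ^+ 5 + X ^+ 2 * Mv * Nv * (rrf ^+ 5) ^+ 2
   - (G * F) * Nv * Mv - X ^+ 2 * F * Nv ^+ 2 * rrf ^+ 5); first by ring.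
rewrite [RHS](_ : _ = G * Mv ^+ 2 * rrf ^+ 5 - 11 * X * (G * F) * Mv * Nv * rrf ^+ 5
    - X ^+ 2 * F * (G * F) * Nv ^+ 2 * rrf ^+ 5 - Nv * Mv * (rrg ^+ 5 * rrf ^+ 5)
    + 11 * X * Nv * Mv * rrf ^+ 5 + X ^+ 2 * Nv * Mv * (rrf ^+ 5) ^+ 2); last by ring.
rewrite y gf; ring.
Qed.

(** The denominator [Mv] is enlarged to [Wv], which by [Wv_sub5] is a series in q^5 and so passes
    through sections. *)
Lemma Wv_rr : Wv * rrf ^+ 5 = F * (Pv * Nv ^+ 2).
Proof.
rewrite -mul_PNM (_ : Pv * Nv * Mv * rrf ^+ 5 = Pv * Nv * (Mv * rrf ^+ 5)); last by ring.
by rewrite rr_pow5; ring.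
Qed.

Lemma Wv_rri : Wv * rrg ^+ 5 = G * (Pv * Mv ^+ 2).
Proof.
have y : rrg ^+ 5 * rrf ^+ 5 = 1 by rewrite -exprMn mulrC rrf_rrg expr1n.
have M' : G * Mv = Nv * rrg ^+ 5.
  rewrite -[G * Mv]mulr1 -y (_ : _ * (_ * _) = G * (Mv * rrf ^+ 5) * rrg ^+ 5); last by ring.
  by rewrite rr_pow5 mulrA sub5_rrg_rrf mul1r.
rewrite -mul_PNM (_ : Pv * Nv * Mv * _ = Pv * Mv * (Nv * rrg ^+ 5)); last by ring.
rewrite -M'; ring.
Qed.

Definition rrw5 := rrw * rrf ^+ 5.

Lemma rrw5E : rrw5 = 1 - 11 * X * rrf ^+ 5 - X ^+ 2 * rrf ^+ 10.
Proof.
have y : rrg ^+ 5 * rrf ^+ 5 = 1 by rewrite -exprMn mulrC rrf_rrg expr1n.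
rewrite /rrw5 /rrw (_ : _ * _ = rrg ^+ 5 * rrf ^+ 5 - 11 * X * rrf ^+ 5
   - X ^+ 2 * rrf ^+ 10); last by ring.
by rewrite y.
Qed.

Lemma Wv_sub5 : Wv = sub5 rrw5.
Proof.
rewrite rrw5E !sub5B (sub5M (11 * X)) (sub5M 11) (sub5M (X ^+ 2)) sub5_1 !sub5_exp sub5X sub5_nat.
rewrite /Wv; ring.
Qed.

Lemma rrw5_inv : rrw5 * (reg5 ^+ 6 * rrg ^+ 5) = 1.
Proof.
have y : rrg ^+ 5 * rrf ^+ 5 = 1 by rewrite -exprMn mulrC rrf_rrg expr1n.
rewrite /rrw5 (_ : _ * _ = reg5 ^+ 6 * rrw * (rrg ^+ 5 * rrf ^+ 5)); last by ring.
by rewrite y reg5_pow mulr1.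
Qed.

End RogersRamanujan.

(** * Sections modulo 5 of f^5, g^5 and f(q^5) g^5 *)

Section Sections.
Variable K : numClosedFieldType.
Local Notation X := (fX K).
Local Notation v := (X * sub5 (rrf K)).

(** [v ^+ 0] and [v ^+ 1] are kept as powers so that [sect5_v] and [sect5_v0] apply to every
    term. *)
Lemma PM2E : Pv K * Mv K ^+ 2 = v ^+ 0 + 5 * v ^+ 1 + 10 * v ^+ 2 + 5 * v ^+ 3 - 15 * v ^+ 4
  - 36 * v ^+ 5 - 40 * v ^+ 6 - 30 * v ^+ 7 - 15 * v ^+ 8 - 5 * v ^+ 9 - v ^+ 10.
Proof. rewrite /Pv /Mv; ring. Qed.

Lemma PN2E : Pv K * Nv K ^+ 2 = v ^+ 0 - 5 * v ^+ 1 + 15 * v ^+ 2 - 30 * v ^+ 3 + 40 * v ^+ 4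
  - 36 * v ^+ 5 + 15 * v ^+ 6 + 5 * v ^+ 7 - 10 * v ^+ 8 + 5 * v ^+ 9 - v ^+ 10.
Proof. rewrite /Pv /Nv; ring. Qed.

Lemma sect5_v r k j : (r < 5)%N -> k = (5 * j + r)%N ->
  sect5 r (v ^+ k) = rrf K ^+ k * X ^+ j.
Proof.
move=> r5 kE; rewrite exprMn -sub5_exp mulrC sect5_sub5Xn // ifT; last by rewrite kE; lia.
by congr (_ * X ^+ _); rewrite kE; lia.
Qed.

Lemma sect5_v0 r k : (r < 5)%N -> (k %% 5 != r)%N -> sect5 r (v ^+ k) = 0.
Proof. by move=> r5 /negPf kr; rewrite exprMn -sub5_exp mulrC sect5_sub5Xn // kr. Qed.

Lemma sect5_natM r n f : (r < 5)%N -> sect5 r (n%:R * f) = n%:R * sect5 r f :> fps K.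
Proof. by move=> r5; rewrite -{1}sub5_nat sect5_sub5M. Qed.

Lemma sect5_PN2_lin r (x0 x1 x2 x3 x4 x5 x6 x7 x8 x9 x10 : fps K) : (r < 5)%N ->
  sect5 r (x0 - 5 * x1 + 15 * x2 - 30 * x3 + 40 * x4 - 36 * x5 + 15 * x6 + 5 * x7 - 10 * x8 + 5 * x9 - x10) =
  sect5 r x0 - 5 * sect5 r x1 + 15 * sect5 r x2 - 30 * sect5 r x3 + 40 * sect5 r x4
  - 36 * sect5 r x5 + 15 * sect5 r x6 + 5 * sect5 r x7 - 10 * sect5 r x8 + 5 * sect5 r x9 - sect5 r x10.
Proof. by move=> r5; rewrite !(sect5D, sect5N) !sect5_natM. Qed.

Lemma sect5_PM2_lin r (x0 x1 x2 x3 x4 x5 x6 x7 x8 x9 x10 : fps K) : (r < 5)%N ->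
  sect5 r (x0 + 5 * x1 + 10 * x2 + 5 * x3 - 15 * x4 - 36 * x5 - 40 * x6 - 30 * x7 - 15 * x8 - 5 * x9 - x10) =
  sect5 r x0 + 5 * sect5 r x1 + 10 * sect5 r x2 + 5 * sect5 r x3 - 15 * sect5 r x4
  - 36 * sect5 r x5 - 40 * sect5 r x6 - 30 * sect5 r x7 - 15 * sect5 r x8 - 5 * sect5 r x9 - sect5 r x10.
Proof. by move=> r5; rewrite !(sect5D, sect5N) !sect5_natM. Qed.

(** Only v^0, v^5 and v^10 survive, with coefficients 1, -36, -1; the 25 is 36 - 11. *)
Lemma sect5_PN2 : sect5 0 (Pv K * Nv K ^+ 2) = rrw5 K - 25 * X * rrf K ^+ 5.
Proof.
rewrite PN2E sect5_PN2_lin //.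
rewrite (@sect5_v 0 0 0) // (@sect5_v 0 5 1) // (@sect5_v 0 10 2) //.
rewrite (@sect5_v0 0 1) // (@sect5_v0 0 2) // (@sect5_v0 0 3) // (@sect5_v0 0 4) //.
rewrite (@sect5_v0 0 6) // (@sect5_v0 0 7) // (@sect5_v0 0 8) // (@sect5_v0 0 9) //.
rewrite rrw5E; ring.
Qed.

Lemma sect5_PM2_0 : sect5 0 (Pv K * Mv K ^+ 2) = rrw5 K - 25 * X * rrf K ^+ 5.
Proof.
rewrite PM2E sect5_PM2_lin //.
rewrite (@sect5_v 0 0 0) // (@sect5_v 0 5 1) // (@sect5_v 0 10 2) //.
rewrite (@sect5_v0 0 1) // (@sect5_v0 0 2) // (@sect5_v0 0 3) // (@sect5_v0 0 4) //.
rewrite (@sect5_v0 0 6) // (@sect5_v0 0 7) // (@sect5_v0 0 8) // (@sect5_v0 0 9) //.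
rewrite rrw5E; ring.
Qed.

Lemma sect5_PM2_1 : sect5 1 (Pv K * Mv K ^+ 2) = 5 * rrf K - 40 * X * rrf K ^+ 6.
Proof.
rewrite PM2E sect5_PM2_lin //.
rewrite (@sect5_v 1 1 0) // (@sect5_v 1 6 1) //.
rewrite (@sect5_v0 1 0) // (@sect5_v0 1 2) // (@sect5_v0 1 3) // (@sect5_v0 1 4) //.
rewrite (@sect5_v0 1 5) // (@sect5_v0 1 7) // (@sect5_v0 1 8) // (@sect5_v0 1 9) //.
rewrite (@sect5_v0 1 10) //; ring.
Qed.

Lemma rri5_rr5 : rrg K ^+ 5 * rrf K ^+ 5 = 1.
Proof. by rewrite -exprMn mulrC rrf_rrg expr1n. Qed.

Lemma rrw5_solve (f g : fps K) : rrw5 K * f = g -> f = reg5 K ^+ 6 * rrg K ^+ 5 * g.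
Proof. by move=> <-; rewrite mulrA [_ * rrw5 K]mulrC rrw5_inv mul1r. Qed.

Lemma rrw5_tail : reg5 K ^+ 6 * rrg K ^+ 5 * (rrw5 K - 25 * X * rrf K ^+ 5) =
  1 - 25 * X * reg5 K ^+ 6.
Proof.
transitivity (rrw5 K * (reg5 K ^+ 6 * rrg K ^+ 5)
  - 25 * X * reg5 K ^+ 6 * (rrg K ^+ 5 * rrf K ^+ 5)); first by ring.
by rewrite rrw5_inv rri5_rr5 mulr1.
Qed.

Lemma sect5_rr5 : sect5 0 (rrf K ^+ 5) = rrf K - 25 * X * (rrf K * reg5 K ^+ 6).
Proof.
have := congr1 (sect5 0) (Wv_rr K).
rewrite Wv_sub5 !sect5_sub5M // sect5_PN2 => /rrw5_solve ->.
rewrite mulrCA rrw5_tail; ring.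
Qed.

Lemma sect5_rri5 : sect5 0 (rrg K ^+ 5) = rrg K - 25 * X * (rrg K * reg5 K ^+ 6).
Proof.
have := congr1 (sect5 0) (Wv_rri K).
rewrite Wv_sub5 !sect5_sub5M // sect5_PM2_0 => /rrw5_solve ->.
rewrite mulrCA rrw5_tail; ring.
Qed.

Lemma sect5_rr_rri5 : sect5 1 (sub5 (rrf K) * rrg K ^+ 5) =
  5 * rrf K + 15 * X * (rrf K * reg5 K ^+ 6) + 5 * X ^+ 2 * (rrf K * reg5 K) ^+ 6.
Proof.
have E : Wv K * (sub5 (rrf K) * rrg K ^+ 5) = Pv K * Mv K ^+ 2.
  rewrite mulrCA Wv_rri mulrA [sub5 (rrf K) * _]mulrC sub5_rrg_rrf mul1r //.
have := congr1 (sect5 1) E.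
rewrite Wv_sub5 (@sect5_sub5M _ _ (rrw5 K)) // sect5_PM2_1 => /rrw5_solve ->.
have W := reg5_pow K; have Y := rri5_rr5.
(* The summand containing 1 - g^5 f^5 is zero; adding it makes the first equality a ring identity
   once [rrw] is unfolded. *)
transitivity (5 * rrf K * (reg5 K ^+ 6 * rrw K) + 15 * X * rrf K * reg5 K ^+ 6
  + 5 * X * rrf K * reg5 K ^+ 6 * (8 * (1 - rrg K ^+ 5 * rrf K ^+ 5))
  + 5 * X ^+ 2 * (rrf K * reg5 K) ^+ 6).
  rewrite /rrw; ring.
rewrite W Y; ring.
Qed.

End Sections.

(** * Signs of the coefficients *)

Section Positivity.
Variable K : numDomainType.
Local Notation X := (fX K).
Implicit Types f g h : fps K.

Definition fge0 f := forall n, 0 <= fcoef f n.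
Definition fge1 f := fge0 (f - 1).

Lemma fge0_1 : fge0 1.
Proof. by move=> n; rewrite fcoef1 ler0n. Qed.
Lemma fge0D f g : fge0 f -> fge0 g -> fge0 (f + g).
Proof. by move=> hf hg n; rewrite fcoefD addr_ge0. Qed.
Lemma fge0M f g : fge0 f -> fge0 g -> fge0 (f * g).
Proof. by move=> hf hg n; rewrite fcoefM sumr_ge0 // => i _; rewrite mulr_ge0. Qed.
Lemma fge0X f n : fge0 f -> fge0 (f ^+ n).
Proof.
move=> hf; elim: n => [|n IH]; first exact: fge0_1.
by rewrite exprS; apply: fge0M.
Qed.
Lemma fge0_fX : fge0 X. Proof. by move=> n; rewrite /= ler0n. Qed.
Lemma fge0_geo k : fge0 (geo K k). Proof. by move=> n; rewrite /= ler0n. Qed.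
Lemma fge1_ge0 f : fge1 f -> fge0 f.
Proof. by move=> /fge0D/(_ fge0_1); rewrite subrK. Qed.
Lemma fge1M f g : fge1 f -> fge1 g -> fge1 (f * g).
Proof.
move=> hf hg; rewrite /fge1 (_ : _ - 1 = f * (g - 1) + (f - 1)); last by ring.
by apply: fge0D => //; apply: fge0M => //; apply: fge1_ge0.
Qed.
Lemma fge1_1 : fge1 1. Proof. by rewrite /fge1 subrr => n; rewrite fcoef0. Qed.
Lemma fge1X f n : fge1 f -> fge1 (f ^+ n).
Proof.
move=> hf; elim: n => [|n IH]; first exact: fge1_1.
by rewrite exprS; apply: fge1M.
Qed.
Lemma fge1_geo k : fge1 (geo K k).
Proof.
move=> n; rewrite fcoefB fcoef1 /=; case: n => [|n]; rewrite ?dvdn0 ?subrr //.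
by rewrite subr0 ler0n.
Qed.
Lemma fge1_prod_geo (m : nat -> nat) N : fge1 (\prod_(k < N) geo K (m k)).
Proof. by elim/big_ind: _ => [|f g|i _]; [exact: fge1_1|exact: fge1M|exact: fge1_geo]. Qed.
Lemma fge1_iprod_geo (m : nat -> nat) : fge1 (iprod (fun k => geo K (m k))).
Proof. by move=> n; apply: fge1_prod_geo. Qed.

(** Realness is recorded because [K] will be a complex field, where a norm bound gives a two-sided
    bound only for real elements. *)
Definition dominated f g := forall n, fcoef f n \is Num.real /\ `|fcoef f n| <= fcoef g n.

Lemma dominated_refl f : fge0 f -> dominated f f.
Proof. by move=> hf n; rewrite ger0_real // ger0_norm. Qed.
Lemma dominatedM f g f' g' : dominated f g -> dominated f' g' -> dominated (f * f') (g * g').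
Proof.
move=> h h' n; rewrite !fcoefM; split.
  by apply: rpred_sum => i _; rewrite rpredM ?(h i).1 ?(h' _).1.
apply: le_trans (ler_norm_sum _ _ _) _; apply: ler_sum => i _.
by rewrite normrM ler_pM ?(h i).2 ?(h' _).2.
Qed.
Lemma dominated_1BXn m : (0 < m)%N -> dominated (1 - X ^+ m) (geo K m).
Proof.
move=> m0 n; rewrite fcoefB fcoefXn fcoef1 /=; split; first by rewrite rpredB // realn.
have [->|n0] := eqVneq n 0%N; first by rewrite (ltn_eqF m0) subr0 dvdn0 normr1.
have [->|nm] := eqVneq n m; first by rewrite sub0r normrN normr1 dvdnn.
by rewrite subr0 normr0 ler0n.
Qed.
Lemma dominated_prod (u w : nat -> fps K) N : (forall k, dominated (u k) (w k)) ->
  dominated (\prod_(k < N) u k) (\prod_(k < N) w k).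
Proof.
move=> h; elim/big_ind2: _ => [|f g f' g'|//]; first exact: dominated_refl fge0_1.
exact: dominatedM.
Qed.
Lemma dominated_poch a b : (0 < a)%N -> dominated (poch K a b) (ipoch K a b).
Proof.
move=> a0 n; apply: (dominated_prod _ (u := fun k => 1 - X ^+ (a + b * k))) => k.
by apply: dominated_1BXn; lia.
Qed.

(* [H = prod 1/(1 - q^(m k))] satisfies [H - 1 <= (sum q^(m k)) H] coefficientwise:
   expand a partition along its largest part. *)
Definition tail_bounded t f := [/\ fge0 t, fge1 f & fge0 (t * f - f + 1)].

Lemma tail_boundedM t f t' f' :
  tail_bounded t f -> tail_bounded t' f' -> tail_bounded (t + t') (f * f').
Proof.
case=> h1 h2 h3 [h1' h2' h3']; split; [exact: fge0D|exact: fge1M|].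
rewrite (_ : _ + 1 = (t * f - f + 1) + t * f * (f' - 1) + f * (t' * f' - f' + 1)).
  apply: fge0D; first apply: fge0D => //; first apply: fge0M => //.
    by apply: fge0M => //; apply: fge1_ge0.
  by apply: fge0M => //; apply: fge1_ge0.
ring.
Qed.

Lemma tail_bounded_geo m : (0 < m)%N -> tail_bounded (X ^+ m) (geo K m).
Proof.
move=> m0; split; [exact: fge0X fge0_fX|exact: fge1_geo|].
rewrite (_ : _ + 1 = 1 - (1 - X ^+ m) * geo K m); last by ring.
by rewrite geoE // subrr => n; rewrite fcoef0.
Qed.

Lemma tail_bounded_prod (m : nat -> nat) N : (forall k, 0 < m k)%N ->
  tail_bounded (\sum_(k < N) X ^+ m k) (\prod_(k < N) geo K (m k)).
Proof.
move=> m0; elim: N => [|N IH]; last first.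
  by rewrite !big_ord_recr /=; apply: tail_boundedM => //; apply: tail_bounded_geo.
rewrite !big_ord0; split; [by move=> n; rewrite fcoef0|exact: fge1_1|].
by rewrite mul0r sub0r addNr => n; rewrite fcoef0.
Qed.

Lemma fcoef_sum_Xn (m : nat -> nat) N n : injective m -> (forall k, 0 < m k)%N ->
  fcoef (\sum_(k < N) X ^+ m k) n <= fcoef (X * geo K 1) n.
Proof.
move=> mI m0; rewrite fcoef_sum fcoefXM.
under eq_bigr do rewrite fcoefXn.
case: n => [|n].
  by rewrite big1 // => k _; case: eqP => // E; have := m0 k; rewrite -E.
rewrite /= dvd1n.
have [/existsP[k /eqP kE]|/existsPn H] := boolP [exists k : 'I_N, n.+1 == m k].
  rewrite (bigD1 k) //= kE eqxx big1 ?addr0 // => j jk.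
  by case: eqP => // /mI/val_inj E; rewrite E eqxx in jk.
by rewrite big1 ?ler01 // => k _; rewrite (negPf (H k)).
Qed.

(** Distinct positive exponents give a sum of powers at most q/(1 - q) coefficientwise; this is fed
    into [tail_bounded_prod] for the first n + 1 factors. *)
Lemma iprod_geo_tail (m : nat -> nat) n : injective m -> (forall k, k < m k)%N ->
  fcoef (iprod (fun k => geo K (m k))) n.+1 <=
  fcoef (geo K 1 * iprod (fun k => geo K (m k))) n.
Proof.
move=> mI mk; set H := iprod _.
have cv : convergent_factors (fun k => geo K (m k)).
  by move=> k; apply: eqm_le (@eqm_geo _ _).
have m0 k : (0 < m k)%N by have := mk k; lia.
have EH := @eqm_iprod _ _ n.+1 cv.
have [_ h1 h2] := tail_bounded_prod n.+1 m0.
have := h2 n.+1; rewrite fcoefD fcoefB fcoef1 addr0 subr_ge0 -EH // => /le_trans; apply.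
rewrite -[leRHS](fcoefXM (geo K 1 * H) n.+1) mulrA.
rewrite [leRHS](eqmM (@eqm_refl _ n.+2 (X * geo K 1)) EH) // -subr_ge0 -fcoefB -mulrBl.
apply: fge0M; last exact: fge1_ge0.
by move=> j; rewrite fcoefB subr_ge0; apply: fcoef_sum_Xn.
Qed.

(** Each coefficient is at most the sum of the earlier ones. The bound serves for convergence in
    [expands_qpoch]. *)
Lemma ipoch_le2n a b n : (0 < a)%N -> (0 < b)%N -> fcoef (ipoch K a b) n <= 2 ^+ n.
Proof.
move=> a0 b0; elim/ltn_ind: n => -[|n] IH; first by rewrite ipoch_0.
apply: le_trans (iprod_geo_tail _ _ _) _; first by move=> i j; nia.
  by move=> k; nia.
rewrite mulrC fcoefM.
apply: (@le_trans _ _ (\sum_(i < n.+1) 2 ^+ i)).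
  apply: ler_sum => i _; rewrite /= dvd1n mulr1; apply: IH.
  by have := ltn_ord i; lia.
elim: n {IH} => [|n IH]; first by rewrite big_ord1 expr0 expr1 ler1n.
by rewrite big_ord_recr /= [2 ^+ n.+2]exprS mulr_natl mulr2n lerD2r.
Qed.

End Positivity.

(** * Comparison of f and g with e, and the three sign results *)

Section Signs.
Variable K : numClosedFieldType.
Local Notation X := (fX K).
Local Notation "'P_' a" := (poch K a 5) (at level 2, a at level 1).
Local Notation "'I_' a" := (ipoch K a 5) (at level 2, a at level 1).

(** The increasing enumeration of the positive integers prime to 5. *)
Definition coprime5 k := (5 * (k %/ 4) + k %% 4 + 1)%N.

(** The four products are interleaved into a single one with injective exponents, the form that
    [iprod_geo_tail] requires. *)
Lemma reg5_iprod : reg5 K = iprod (fun k => geo K (coprime5 k)).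
Proof.
have cv : convergent_factors (fun k => geo K (coprime5 k)).
  by move=> k; apply: eqm_le (@eqm_geo _ _); rewrite /coprime5; lia.
apply: eqmP => N; apply: (@eqm_le _ _ N.+1) => //.
apply: (@eqm_trans _ _ _ (\prod_(k < 4 * N) geo K (coprime5 k))); last first.
  by apply: (@eqm_le _ _ (4 * N).+1); [lia|apply: eqm_sym; apply: eqm_iprod].
rewrite (_ : \prod_(k < 4 * N) _ = (\prod_(k < N) geo K (1 + 5 * k)) *
  (\prod_(k < N) geo K (2 + 5 * k)) * (\prod_(k < N) geo K (3 + 5 * k)) *
  (\prod_(k < N) geo K (4 + 5 * k))).
  by do !apply: eqmM; apply: eqm_iprod; apply: cvf_ipoch.
elim: N => [|N IH]; first by rewrite !big_ord0 !mulr1.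
rewrite mulnSr !addnS addn0 !big_ord_recr IH /=.
have -> : coprime5 (4 * N) = (1 + 5 * N)%N by rewrite /coprime5; lia.
have -> : coprime5 (4 * N).+1 = (2 + 5 * N)%N by rewrite /coprime5; lia.
have -> : coprime5 (4 * N).+2 = (3 + 5 * N)%N by rewrite /coprime5; lia.
have -> : coprime5 (4 * N).+3 = (4 + 5 * N)%N by rewrite /coprime5; lia.
ring.
Qed.

Lemma fge1_ipoch a b : fge1 (ipoch K a b).
Proof. exact: fge1_iprod_geo. Qed.

Lemma fge1_reg5 : fge1 (reg5 K).
Proof. by do !apply: fge1M; apply: fge1_ipoch. Qed.

Lemma ipoch1_geo : fge0 (I_ 1 - geo K 1).
Proof.
move=> n; rewrite fcoefB subr_ge0.
rewrite (@eqm_iprod _ _ n.+1 (@cvf_ipoch K 1 5 isT isT)) // big_ord_recl /= -subr_ge0.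
have := fge0M (fge0_geo K 1) (fge1_prod_geo K (fun k => 1 + 5 * bump 0 k)%N n).
by move=> /(_ n); rewrite mulrBr mulr1 fcoefB.
Qed.

(** Partial sums of the coefficients of e. They are the common scale: upper bounds for f and g one
    degree higher, lower bounds for f e^6 and g e^6. *)
Definition reg5_psum n := fcoef (geo K 1 * reg5 K) n.

Lemma reg5_psum_gt0 n : 0 < reg5_psum n.
Proof.
have /(_ n) := fge0M (fge0_geo K 1) fge1_reg5.
rewrite mulrBr mulr1 fcoefB subr_ge0 => /(lt_le_trans _); apply.
by rewrite /= dvd1n ltr01.
Qed.

Lemma reg5_le_psum n : fcoef (reg5 K) n.+1 <= reg5_psum n.
Proof.
rewrite /reg5_psum reg5_iprod; apply: iprod_geo_tail; rewrite /coprime5 => k; last lia.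
by move=> j; lia.
Qed.

Lemma reg5_psum_le (f : fps K) n : fge1 f -> reg5_psum n <= fcoef (reg5 K * I_ 1 * f) n.
Proof.
move=> hf; rewrite /reg5_psum -subr_ge0 -fcoefB.
rewrite (_ : _ - _ = reg5 K * ((I_ 1 - geo K 1) + I_ 1 * (f - 1))); last by ring.
apply: fge0M; first exact: fge1_ge0 fge1_reg5.
apply: fge0D; first exact: ipoch1_geo.
by apply: fge0M => //; apply: fge1_ge0; apply: fge1_ipoch.
Qed.

Lemma rr_reg5 : rrf K * reg5 K = (I_ 2 * I_ 3) ^+ 2.
Proof.
rewrite (_ : rrf K * reg5 K = P_ 1 * I_ 1 * (P_ 4 * I_ 4) * (I_ 2 * I_ 3) ^+ 2).
  by rewrite !poch_ipoch5 // !mul1r.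
rewrite /rrf /reg5; ring.
Qed.
Lemma rri_reg5 : rrg K * reg5 K = (I_ 1 * I_ 4) ^+ 2.
Proof.
rewrite (_ : rrg K * reg5 K = P_ 2 * I_ 2 * (P_ 3 * I_ 3) * (I_ 1 * I_ 4) ^+ 2).
  by rewrite !poch_ipoch5 // !mul1r.
rewrite /rrg /reg5; ring.
Qed.

(** One factor e is kept and another is opened up, whose [I_ 1] majorizes 1/(1 - q); what remains is
    a series of type [fge1]. *)
Lemma reg5_psum_le_pow (f : fps K) n : fge1 f -> reg5_psum n <= fcoef (f * reg5 K ^+ 5) n.
Proof.
move=> hf; rewrite (_ : f * _ = reg5 K * I_ 1 * (I_ 2 * I_ 3 * I_ 4 * reg5 K ^+ 3 * f)).
  apply: reg5_psum_le; apply: fge1M => //; apply: fge1M; last by apply: fge1X; apply: fge1_reg5.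
  by do !apply: fge1M; apply: fge1_ipoch.
rewrite /reg5; ring.
Qed.

Lemma reg5_psum_rr n : reg5_psum n <= fcoef (rrf K * reg5 K ^+ 6) n.
Proof.
rewrite exprS mulrA rr_reg5; apply: reg5_psum_le_pow; apply: fge1X.
by apply: fge1M; apply: fge1_ipoch.
Qed.
Lemma reg5_psum_rri n : reg5_psum n <= fcoef (rrg K * reg5 K ^+ 6) n.
Proof.
rewrite exprS mulrA rri_reg5; apply: reg5_psum_le_pow; apply: fge1X.
by apply: fge1M; apply: fge1_ipoch.
Qed.

Lemma dominated_ipoch a : dominated I_ a I_ a.
Proof. by apply: dominated_refl; apply: fge1_ge0; apply: fge1_ipoch. Qed.

(** Replacing each factor 1 - q^m of f by 1/(1 - q^m) turns f into e. *)
Lemma dominated_rr : dominated (rrf K) (reg5 K).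
Proof.
rewrite (_ : reg5 K = I_ 1 * I_ 4 * I_ 2 * I_ 3); last by rewrite /reg5; ring.
by do !apply: dominatedM; try exact: dominated_ipoch; apply: dominated_poch.
Qed.
Lemma dominated_rri : dominated (rrg K) (reg5 K).
Proof.
rewrite (_ : reg5 K = I_ 2 * I_ 3 * I_ 1 * I_ 4); last by rewrite /reg5; ring.
by do !apply: dominatedM; try exact: dominated_ipoch; apply: dominated_poch.
Qed.

Lemma dominated_le (f g : fps K) n : dominated f g -> - fcoef g n <= fcoef f n <= fcoef g n.
Proof. by move=> /(_ n)[fr]; rewrite real_ler_norml. Qed.

Lemma fcoef_natM m (f : fps K) n : fcoef (m%:R * f) n = m%:R * fcoef f n.
Proof. by rewrite !mulr_natl fcoefMn. Qed.

Lemma fcoef_sect5 r (f : fps K) n : fcoef f (5 * n + r) = fcoef (sect5 r f) n.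
Proof. by []. Qed.

(** With s = [reg5_psum n] > 0, the coefficient of f is at most s, that of 25 q f e^6 at least 25
    s. *)
Lemma rr5_lt0 n : fcoef (rrf K ^+ 5) (5 * n.+1) < 0.
Proof.
rewrite -[(5 * _)%N]addn0 fcoef_sect5 sect5_rr5 fcoefB -mulrA fcoef_natM fcoefXM.
have /andP[_ h] := dominated_le n.+1 dominated_rr.
rewrite subr_lt0; apply: le_lt_trans (le_trans h (reg5_le_psum n)) _.
apply: lt_le_trans (ler_wpM2l (ler0n _ 25) (reg5_psum_rr n)).
by rewrite mulr_natl mulrSr ltrDr pmulrn_lgt0 ?reg5_psum_gt0.
Qed.

Lemma rri5_lt0 n : fcoef (rrg K ^+ 5) (5 * n.+1) < 0.
Proof.
rewrite -[(5 * _)%N]addn0 fcoef_sect5 sect5_rri5 fcoefB -mulrA fcoef_natM fcoefXM.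
have /andP[_ h] := dominated_le n.+1 dominated_rri.
rewrite subr_lt0; apply: le_lt_trans (le_trans h (reg5_le_psum n)) _.
apply: lt_le_trans (ler_wpM2l (ler0n _ 25) (reg5_psum_rri n)).
by rewrite mulr_natl mulrSr ltrDr pmulrn_lgt0 ?reg5_psum_gt0.
Qed.

(** The last term of the section is nonnegative. With s = [reg5_psum n], the other two contribute at
    least -5 s + 15 s in degree n + 1; degree 0 has the value 5. *)
Lemma rr_rri5_gt0 n : 0 < fcoef (sub5 (rrf K) * rrg K ^+ 5) (5 * n + 1).
Proof.
rewrite fcoef_sect5 sect5_rr_rri5 fcoefD.
apply: ltr_pwDl; last first.
  rewrite -mulrA fcoef_natM; apply: mulr_ge0; first exact: ler0n.
  apply: fge0M; first by apply: fge0X; apply: fge0_fX.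
  rewrite rr_reg5; do !apply: fge0X; apply: fge0M; apply: fge1_ge0; exact: fge1_ipoch.
rewrite fcoefD -mulrA !fcoef_natM fcoefXM; case: n => [|n].
  rewrite mulr0 addr0 mulr_gt0 ?ltr0n //.
  by rewrite !fcoef0M !poch_0 !ipoch_0 !mulr1 ltr01.
have /andP[h _] := dominated_le n.+1 dominated_rr.
have h' : - reg5_psum n <= fcoef (rrf K) n.+1 by apply: le_trans h; rewrite lerN2 reg5_le_psum.
apply: lt_le_trans (lerD (ler_wpM2l (ler0n _ 5) h') (ler_wpM2l (ler0n _ 15) (reg5_psum_rr n))).
rewrite (_ : _ + _ = 10 * reg5_psum n); last by ring.
by rewrite mulr_gt0 ?ltr0n ?reg5_psum_gt0.
Qed.
End Signs.

Local Open Scope classical_set_scope.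

(** * Convergent expansions near 0 *)

Section Expansions.
Variable K : numFieldType.
(** The two analytic inputs about [K], supplied for R[i] by [complex_half_cvg0] and
    [complex_geometric_cvg]. *)
Hypothesis half_cvg0 : (fun n => 2^-1 ^+ n : K) @ \oo --> (0 : K).
Hypothesis geometric_cvg : forall (u : nat -> K) (C : K),
  (forall n, `|u n.+1 - u n| <= C * 2^-1 ^+ n) -> cvg (u @ \oo).
Implicit Types (f g : fps K) (F G : K -> K).

Lemma half_gt0 : 0 < 2^-1 :> K. Proof. by rewrite invr_gt0 ltr0n. Qed.

Lemma ler_mulD1 (C x : K) : 0 <= x -> C * x <= (C + 1) * x.
Proof. by move=> x0; rewrite mulrDl mul1r lerDl. Qed.

Lemma ler_pow_half (x : K) n : 0 <= x -> x <= 2^-1 -> x ^+ n <= 2^-1 ^+ n.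
Proof. by move=> x0 xh; rewrite lerXn2r ?nnegrE // (le_trans x0 xh). Qed.

Lemma cvg_near_half (u w : nat -> K) (C l : K) : 0 <= C ->
  (forall n, `|w n - u n| <= C * 2^-1 ^+ n) -> u @ \oo --> l -> w @ \oo --> l.
Proof.
move=> C0 H ul.
have wu0 : (fun n => w n - u n) @ \oo --> (0 : K).
  apply/cvgr0Pnorm_lt => e e0.
  have e1 : 0 < e / (C + 1) by rewrite divr_gt0 // ltr_wpDl.
  have /cvgr0Pnorm_lt/(_ _ e1) := half_cvg0.
  apply: filterS => n; rewrite ger0_norm ?exprn_ge0 ?ltW ?half_gt0 // => hn.
  apply: le_lt_trans (H n) _.
  apply: (@le_lt_trans _ _ ((C + 1) * 2^-1 ^+ n)).
    by apply: ler_mulD1; rewrite exprn_ge0 // ltW ?half_gt0.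
  by rewrite mulrC -ltr_pdivlMr // ltr_wpDl.
rewrite (_ : w = (fun n => u n + (w n - u n))).
  by rewrite -[l]addr0; apply: cvgD.
by apply/funext => n; rewrite addrC subrK.
Qed.

Definition pterm f (q : K) := fun n => fcoef f n * q ^+ n.
Definition exp_bounded f :=
  exists C M : K, [/\ 0 <= C, 0 < M & forall n, `|fcoef f n| <= C * M ^+ n].
(** The coefficient bound controls tails near 0; the punctured neighbourhood allows division by q in
    [expands0]. *)
Definition expands f F :=
  exp_bounded f /\ \forall q \near (0 : K)^', series (pterm f q) @ \oo --> F q.

Lemma geo_sum_le (x : K) n : 0 <= x -> x <= 2^-1 -> \sum_(i < n) x ^+ i <= 2.
Proof.
move=> x0 x1; elim: n => [|n IH]; first by rewrite big_ord0 ler0n.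
rewrite big_ord_recl expr0.
under eq_bigr do rewrite /= /bump /= add1n exprS.
rewrite -mulr_sumr -[leRHS]/(1 + 1) lerD2l.
apply: le_trans (ler_pM _ _ x1 IH) _ => //; last by rewrite mulVf // pnatr_eq0.
by apply: sumr_ge0 => i _; rewrite exprn_ge0.
Qed.

Lemma tail_le (c : nat -> K) (C M q : K) N L : 0 <= C -> 0 < M ->
  (forall n, `|c n| <= C * M ^+ n) -> M * `|q| <= 2^-1 ->
  `|\sum_(N <= n < L) c n * q ^+ n| <= 2 * C * (M * `|q|) ^+ N.
Proof.
move=> C0 M0 cM q1.
have x0 : 0 <= M * `|q| by rewrite mulr_ge0 // ltW.
apply: le_trans (ler_norm_sum _ _ _) _.
apply: (@le_trans _ _ (\sum_(N <= n < L) C * (M * `|q|) ^+ n)).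
  apply: ler_sum => n _; rewrite normrM normrX exprMn mulrA.
  by rewrite ler_wpM2r ?exprn_ge0.
rewrite -mulr_sumr -[N in index_iota N _]add0n big_addn.
under eq_bigr do rewrite exprD.
rewrite -mulr_suml big_mkord [2 * C]mulrC -mulrA; apply: ler_wpM2l => //.
by apply: ler_wpM2r; [exact: exprn_ge0|exact: geo_sum_le].
Qed.

Lemma near_small (M : K) : 0 < M -> \forall q \near (0 : K)^', M * `|q| <= 2^-1.
Proof.
move=> M0; have e0 : 0 < 2^-1 / M by rewrite divr_gt0 ?half_gt0.
have := @dnbhs0_lt K K _ e0; apply: filterS => q /ltW.
by rewrite ler_pdivlMr // mulrC.
Qed.

Lemma expands_coef0 f F : expands f F ->
  exists2 C : K, 0 <= C & \forall q \near (0 : K)^', `|F q - fcoef f 0| <= C * `|q|.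
Proof.
case=> -[C [M [C0 M0 fM]]] cv; exists (2 * C * M + 1).
  by rewrite addr_ge0 ?ler01 // !mulr_ge0 ?ler0n // ltW.
near=> q.
have q0 : 0 < `|q| by rewrite normr_gt0; near: q; exact: nbhs_dnbhs_neq.
have qs : M * `|q| <= 2^-1 by near: q; exact: near_small.
have : series (pterm f q) @ \oo --> F q by near: q.
(* A partial sum within |q| of [F q] accounts for the 1 in the constant, its terms of positive
   degree for 2 C M. *)
move=> /cvgrPdist_lt/(_ _ q0)[N _ /(_ N.+1 (leqnSn N))] /= H.
rewrite mulrDl mul1r [leRHS]addrC.
rewrite (_ : F q - _ = (F q - series (pterm f q) N.+1) + (series (pterm f q) N.+1 - fcoef f 0)).
  apply: le_trans (ler_normD _ _) (lerD (ltW H) _).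
  rewrite /series /= big_nat_recl // /pterm expr0 mulr1 addrAC subrr add0r.
  rewrite (_ : \sum_(0 <= i < N) _ = \sum_(1 <= n < N.+1) fcoef f n * q ^+ n).
    by apply: le_trans (@tail_le _ C M q 1 N.+1 C0 M0 fM qs) _; rewrite expr1 mulrA.
  by rewrite big_add1.
ring.
Unshelve. all: by end_near. Qed.

Lemma expands_neq0 f F : expands f F -> fcoef f 0 = 1 ->
  \forall q \near (0 : K)^', F q != 0.
Proof.
move=> ef f0; have [C C0] := expands_coef0 ef; rewrite f0 => H.
have C1 : 0 < C + 1 by rewrite ltr_wpDl.
near=> q.
have : `|F q - 1| <= C * `|q| by near: q.
apply: contraTneq => ->; rewrite sub0r normrN normr1.
have qs : (C + 1) * `|q| <= 2^-1 by near: q; exact: near_small.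
have : C * `|q| < 1.
  apply: (@le_lt_trans _ _ ((C + 1) * `|q|)); first exact: ler_mulD1.
  by apply: le_lt_trans qs _; rewrite invf_lt1 ?ltr0n // ltr1n.
by move=> h1; apply/negP => h2; have := le_lt_trans h2 h1; rewrite ltxx.
Unshelve. all: by end_near. Qed.

Definition fshift f : fps K := Fps (fun n => fcoef f n.+1).

(** The constant term vanishes by [expands_coef0]; division by q then passes to the shifted
    series. *)
Lemma expands0 f : expands f (fun=> 0) -> f = 0.
Proof.
have Z g : expands g (fun=> 0) -> fcoef g 0 = 0.
  move=> /expands_coef0[C C0 H]; apply/eqP; apply: contraT => g0.
  have g1 : 0 < `|fcoef g 0| by rewrite normr_gt0.
  have C1 : 0 < C + 1 by rewrite ltr_wpDl.
  have e0 : 0 < `|fcoef g 0| / (C + 1) by rewrite divr_gt0.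
  have [q [h1 h2]] := filter_ex (filterI H (@dnbhs0_lt K K _ e0)).
  move: h1; rewrite sub0r normrN => h1.
  have h3 : (C + 1) * `|q| < `|fcoef g 0| by rewrite mulrC -ltr_pdivlMr.
  have := le_lt_trans h1 (le_lt_trans _ h3); rewrite ltxx; apply.
  exact: ler_mulD1.
have S g : expands g (fun=> 0) -> expands (fshift g) (fun=> 0).
  move=> eg; have g0 := Z g eg; case: eg => -[C [M [C0 M0 gM]]] cv; split.
    exists (C * M), M; split => //; first by rewrite mulr_ge0 // ltW.
    by move=> n; rewrite -mulrA -exprS; apply: gM.
  near=> q.
  have q0 : q != 0 by near: q; exact: nbhs_dnbhs_neq.
  have cq : series (pterm g q) @ \oo --> (0 : K) by near: q.
  rewrite -cvg_shiftS in cq.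
  rewrite (_ : series _ = (fun n => q^-1 * series (pterm g q) n.+1)).
    by rewrite -[X in _ --> X](mulr0 q^-1); apply: cvgM => //; apply: cvg_cst.
  apply/funext => n; rewrite /series /= big_nat_recl // /pterm g0 mul0r add0r mulr_sumr.
  by apply: eq_bigr => i _; rewrite exprS (mulrCA _ q) mulKf.
move=> ef; apply: fpsP => n; rewrite fcoef0.
elim: n f ef => [|n IH] f ef; first exact: Z.
by have := IH _ (S _ ef).
Unshelve. all: by end_near. Qed.

(** Arbitrary [a] and [b] are allowed so that truncations are covered in [expandsM]. The 2 in the
    new ratio absorbs the n + 1 terms. *)
Lemma exp_boundedM f g : exp_bounded f -> exp_bounded g -> exists C M : K,
  [/\ 0 <= C, 0 < M & forall (a b : nat -> K) n,
   (forall i, `|a i| <= `|fcoef f i|) -> (forall i, `|b i| <= `|fcoef g i|) ->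
   `|\sum_(i < n.+1) a i * b (n - i)%N| <= C * M ^+ n].
Proof.
move=> [C [M [C0 M0 fM]]] [C' [M' [C0' M0' gM]]].
exists (C * C'), (2 * (M + M')); split.
- exact: mulr_ge0.
- by rewrite mulr_gt0 ?ltr0n // addr_gt0.
move=> a b n ha hb; apply: le_trans (ler_norm_sum _ _ _) _.
apply: (@le_trans _ _ (\sum_(i < n.+1) C * C' * (M + M') ^+ n)).
  apply: ler_sum => i _; rewrite normrM.
  have ai : `|a i| <= C * (M + M') ^+ i.
    apply: le_trans (ha i) (le_trans (fM i) _); rewrite ler_wpM2l //.
    by rewrite lerXn2r ?nnegrE ?addr_ge0 // ?lerDl ltW.
  have bi : `|b (n - i)%N| <= C' * (M + M') ^+ (n - i).
    apply: le_trans (hb _) (le_trans (gM _) _); rewrite ler_wpM2l //.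
    by rewrite lerXn2r ?nnegrE ?addr_ge0 // ?lerDr ltW.
  apply: le_trans (ler_pM _ _ ai bi) _ => //.
  by rewrite mulrACA -exprD subnKC // -ltnS.
rewrite sumr_const card_ord exprMn -[leLHS]mulr_natl [leLHS]mulrCA.
apply: ler_wpM2l; first exact: mulr_ge0.
apply: ler_wpM2r; first by rewrite exprn_ge0 // addr_ge0 // ltW.
by rewrite -natrX ler_nat ltn_expl.
Qed.

Lemma horner_series f q N : (ftrunc N f).[q] = series (pterm f q) N.
Proof.
rewrite (@horner_coef_wide _ N) ?size_poly // /series /= big_mkord.
by apply: eq_bigr => i _; rewrite coef_ftrunc.
Qed.

(** The product of the N-th partial sums differs from that of [f * g] only in degrees from N to 2N,
    a tail of size 2^-N. *)
Lemma expandsM f g F G : expands f F -> expands g G ->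
  expands (f * g) (fun q => F q * G q).
Proof.
move=> [bf cf] [bg cg]; have [C [M [C0 M0 H]]] := exp_boundedM bf bg.
split; first by exists C, M; split => // n; apply: H.
near=> q.
have qs : M * `|q| <= 2^-1 by near: q; exact: near_small.
have cfq : series (pterm f q) @ \oo --> F q by near: q.
have cgq : series (pterm g q) @ \oo --> G q by near: q.
apply: (@cvg_near_half _ _ (2 * C) _ _ _ (cvgM cfq cgq)); first by rewrite mulr_ge0.
move=> N; rewrite distrC /=.
set p := ftrunc N f * ftrunc N g.
have -> : series (pterm f q) N * series (pterm g q) N = \sum_(0 <= n < N + N) p`_n * q ^+ n.
  rewrite -!horner_series -hornerM -/p (@horner_coef_wide _ (N + N)) ?big_mkord //.
  apply: leq_trans (size_polyMleq _ _) _.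
  by apply: leq_trans (leq_pred _) (leq_add _ _); apply: size_poly.
rewrite (@big_cat_nat _ _ _ N) ?leq_addr //=.
rewrite (_ : \sum_(0 <= i < N) _ = series (pterm (f * g) q) N).
  rewrite addrAC subrr add0r.
  apply: le_trans (@tail_le _ C M q N _ C0 M0 _ qs) _; last first.
    apply: ler_wpM2l; first by rewrite mulr_ge0.
    by apply: ler_pow_half => //; rewrite mulr_ge0 // ltW.
  move=> n; rewrite coefM; apply: (H (fun i => (ftrunc N f)`_i) (fun i => (ftrunc N g)`_i)) => i.
    by rewrite coef_poly; case: ifP => // _; rewrite normr0.
  by rewrite coef_poly; case: ifP => // _; rewrite normr0.
rewrite /series /= !big_nat; apply: eq_bigr => n /= nN.
by rewrite /pterm (@fps_mul_trunc _ N).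
Unshelve. all: by end_near. Qed.

Lemma expands_near f F G : expands f F -> (\forall q \near (0 : K)^', F q = G q) ->
  expands f G.
Proof.
move=> [bf cf] H; split=> //; near=> q.
have <- : F q = G q by near: q.
by near: q.
Unshelve. all: by end_near. Qed.

Lemma expandsB f g F G : expands f F -> expands g G -> expands (f - g) (fun q => F q - G q).
Proof.
move=> [[C [M [C0 M0 fM]]] cf] [[C' [M' [C0' M0' gM]]] cg]; split.
  exists (C + C'), (M + M'); split; [exact: addr_ge0|exact: addr_gt0|].
  move=> n; rewrite fcoefB mulrDl; apply: le_trans (ler_normB _ _) (lerD _ _).
    apply: le_trans (fM n) _; rewrite ler_wpM2l //.
    by rewrite lerXn2r ?nnegrE ?addr_ge0 // ?lerDl ltW.
  apply: le_trans (gM n) _; rewrite ler_wpM2l //.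
  by rewrite lerXn2r ?nnegrE ?addr_ge0 // ?lerDr ltW.
near=> q.
have cfq : series (pterm f q) @ \oo --> F q by near: q.
have cgq : series (pterm g q) @ \oo --> G q by near: q.
rewrite (_ : series _ = series (pterm f q) - series (pterm g q)).
  exact: cvgB cfq cgq.
apply/funext => n; rewrite /series /= fctE /= -sumrB; apply: eq_bigr => i _.
by rewrite /pterm fcoefB mulrBl.
Unshelve. all: by end_near. Qed.

Lemma expands_unique f g F : expands f F -> expands g F -> f = g.
Proof.
move=> ef eg; apply/subr0_eq/expands0.
by apply: expands_near (expandsB ef eg) _; near=> q; rewrite subrr.
Unshelve. all: by end_near. Qed.

Lemma expandsX f F n : expands f F -> expands (f ^+ n.+1) (fun q => F q ^+ n.+1).
Proof.
move=> ef; elim: n => [|n IH]; first exact: ef.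
exact: expandsM ef IH.
Qed.

(** Convergence at q = 1/2 bounds the partial sums, hence the terms, which gives growth at most
    2^n. *)
Lemma is_qexpansion_expands (c : nat -> int) F : is_qexpansion c F ->
  expands (Fps (fun n => (c n)%:~R)) F.
Proof.
move=> H; split; last first.
  by have := @dnbhs0_lt K K 1 ltr01; apply: filterS => q; apply: H.
have h1 : `|2^-1 : K| < 1.
  by rewrite gtr0_norm ?half_gt0 // invf_lt1 ?ltr0n // ltr1n.
have /cvgP/cvg_seq_bounded/pinfty_ex_gt0[M M0 /= uM] := H _ h1.
exists (M + M), 2; split; [by rewrite addr_ge0 // ltW|by rewrite ltr0n|].
move=> n; have := lerD (uM n.+1 I) (uM n I).
rewrite /= => /(le_trans (ler_normB _ _)).
rewrite /series /= big_nat_recr //= addrAC subrr add0r normrM normrX.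
by rewrite (gtr0_norm half_gt0) exprVn ler_pdivrMr ?exprn_gt0 ?ltr0n.
Qed.

Definition pfps (p : {poly K}) : fps K := Fps (fun n => p`_n).

Lemma pfpsM p r : pfps (p * r) = pfps p * pfps r.
Proof. by apply: fpsP => n; rewrite /= coefM. Qed.

Lemma prod_geo_le_iprod (m : nat -> nat) N n : (forall k, k < m k)%N ->
  fcoef (\prod_(k < N) geo K (m k)) n <= fcoef (iprod (fun k => geo K (m k))) n.
Proof.
move=> mk.
have cv : convergent_factors (fun k => geo K (m k)).
  by move=> k; apply: eqm_le (@eqm_geo _ _).
case: (leqP n N) => nN; first by rewrite (@eqm_iprod _ _ N cv).
have [d ->] : exists d, n = (N + d)%N by exists (n - N)%N; lia.
rewrite -[leRHS]/(fcoef (\prod_(k < N + d) geo K (m k)) (N + d)) big_split_ord.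
rewrite -subr_ge0 -fcoefB -[X in _ - X]mulr1 -mulrBr.
apply: fge0M; first exact/fge1_ge0/fge1_prod_geo.
exact: (@fge1_prod_geo K (fun k => m (N + k)%N)).
Qed.

(** The partial products are polynomials [p N] with coefficients bounded by 2^n uniformly in N,
    agreeing with [poch K a b] up to degree N; so they differ from the partial sums of the series by
    a small tail. *)
Lemma expands_qpoch a b : (0 < a)%N -> (0 < b)%N ->
  expands (poch K a b) (fun q => qpoch (q ^+ a) (q ^+ b)).
Proof.
move=> a0 b0.
have B n : `|fcoef (poch K a b) n| <= 1 * 2 ^+ n.
  by rewrite mul1r; apply: le_trans (@dominated_poch K a b a0 n).2 (@ipoch_le2n K a b n a0 b0).
split; first by exists 1, 2; split; rewrite ?ler01 ?ltr0n.
near=> q.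
have qs : 2 * `|q| <= 2^-1 by near: q; apply: near_small; rewrite ltr0n.
pose p N : {poly K} := \prod_(k < N) (1 - 'X^(a + b * k)).
have pE N : \prod_(k < N) (1 - q ^+ a * (q ^+ b) ^+ k) = (p N).[q].
  by rewrite horner_prod; apply: eq_bigr => k _; rewrite !hornerE -exprM -exprD.
have pF N n : (p N)`_n = fcoef (\prod_(k < N) (1 - fX K ^+ (a + b * k))) n.
  rewrite -[LHS]/(fcoef (pfps (p N)) n); congr fcoef.
  rewrite /p; elim: (index_enum _) => [|k s IH].
    by rewrite !big_nil; apply: fpsP => -[|i]; rewrite /= coef1.
  rewrite !big_cons pfpsM IH; congr (_ * _); apply: fpsP => i.
  by rewrite fcoefB fcoefXn fcoef1 /= coefB coef1 coefXn.
have pB N n : `|(p N)`_n| <= 1 * 2 ^+ n.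
  rewrite pF mul1r.
  apply: le_trans (@dominated_prod K (fun k => 1 - fX K ^+ (a + b * k))
    (fun k => geo K (a + b * k)) N _ n).2 _.
    by move=> k; apply: dominated_1BXn; lia.
  apply: le_trans (@ipoch_le2n K a b n a0 b0).
  by apply: (@prod_geo_le_iprod (fun k => a + b * k)%N) => k; nia.
have /cvg_ex[l cl] : cvg (series (pterm (poch K a b) q) @ \oo).
  apply: (@geometric_cvg _ 1) => n.
  rewrite /series /= big_nat_recr //= addrAC subrr add0r normrM normrX mul1r.
  apply: le_trans (ler_wpM2r _ (B n)) _; first exact: exprn_ge0.
  by rewrite mul1r -exprMn; apply: ler_pow_half => //; rewrite mulr_ge0.
suff cp : (fun n : nat => \prod_(k < n) (1 - q ^+ a * (q ^+ b) ^+ k)) @ \oo --> l.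
  by rewrite /qpoch (cvg_lim _ cp) //; exact: norm_hausdorff.
apply: (@cvg_near_half _ _ 2 _ _ _ cl) => // N; rewrite pE.
pose L := maxn (size (p N)) N.
rewrite (@horner_coef_wide _ L) ?leq_maxl // -(big_mkord xpredT (fun i => (p N)`_i * q ^+ i)).
rewrite (@big_cat_nat _ _ _ N) ?leq_maxr //=.
rewrite (_ : \sum_(0 <= i < N) _ = series (pterm (poch K a b) q) N).
  rewrite addrAC subrr add0r.
  apply: le_trans (@tail_le _ 1 2 q N _ ler01 _ (pB N) qs) _; first by rewrite ltr0n.
  rewrite mulr1; apply: ler_wpM2l => //.
  by apply: ler_pow_half => //; rewrite mulr_ge0.
rewrite /series /= !big_nat; apply: eq_bigr => n /= nN.
by rewrite /pterm (@eqm_iprod _ _ N (cvf_poch K a0 b0)) ?pF //; lia.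
Unshelve. all: by end_near. Qed.

End Expansions.

Local Open Scope complex_scope.

(** * Geometric convergence in R[i] *)

Section ComplexLimits.
Variable R : realType.
Local Notation K := (R[i] : numFieldType).

Lemma normC_real (x : R) : `|x%:C| = `|x|%:C :> R[i].
Proof. by rewrite normc_def /= expr0n /= addr0 sqrtr_sqr. Qed.

Lemma complex_gt0 (e : R[i]) : 0 < e -> exists2 x : R, 0 < x & e = x%:C.
Proof.
case: e => x y; rewrite ltcE /= => /andP[/eqP -> x0].
by exists x.
Qed.

Lemma complex_half n : 2^-1 ^+ n = ((2^-1 : R) ^+ n)%:C :> R[i].
Proof. by rewrite rmorphXn fmorphV rmorph_nat. Qed.

Lemma complex_half_cvg0 : (fun n => 2^-1 ^+ n : K) @ \oo --> (0 : K).
Proof.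
apply/cvgr0Pnorm_lt => e /complex_gt0[x x0 ->].
have h1 : `|2^-1 : R| < 1 by rewrite ger0_norm // invf_lt1 // ltr1n.
have /cvgr0Pnorm_lt/(_ _ x0) := cvg_expr h1.
by apply: filterS => n; rewrite complex_half normC_real ltcR.
Qed.

Lemma real_geometric_cvg (x : nat -> R) (c : R) :
  (forall n, `|x n.+1 - x n| <= c * 2^-1 ^+ n) -> cvg (x @ \oo).
Proof.
move=> H.
have h1 : `|2^-1 : R| < 1 by rewrite ger0_norm // invf_lt1 // ltr1n.
have /normed_cvg ct : cvgn [normed series (telescope x)].
  apply: (@series_le_cvg _ (fun n => `|telescope x n|) (geometric c 2^-1)) => [n|n|n|] //.
  - exact: le_trans (H n).
  - exact: H.
  exact: is_cvg_geometric_series.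
rewrite (_ : x = (fun n => x 0%N + series (telescope x) n)).
  by apply: is_cvgD => //; apply: is_cvg_cst.
by apply/funext => n; apply: eq_sum_telescope.
Qed.

Lemma norm_Im_le (z : R[i]) : `|complex.Im z|%:C <= `|z|.
Proof.
rewrite normc_def lecR -sqrtr_sqr ler_wsqrtr //.
by rewrite lerDr sqr_ge0.
Qed.
Lemma norm_le_ReIm (z : R[i]) : `|z| <= (`|complex.Re z| + `|complex.Im z|)%:C.
Proof.
rewrite {1}[z]complexE; apply: le_trans (ler_normD _ _) _.
rewrite rmorphD /= normrM !normC_real (_ : `|'i%C| = 1) ?mul1r //.
by rewrite normc_def /= expr0n expr1n /= add0r sqrtr1.
Qed.

Lemma complex_geometric_cvg (u : nat -> K) (C : K) :
  (forall n, `|u n.+1 - u n| <= C * 2^-1 ^+ n) -> cvg (u @ \oo).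
Proof.
move=> H.
(* In R[i] a nonnegative [C] is real, so the bound passes to real and imaginary parts. *)
have C0 : 0 <= C by have := le_trans (normr_ge0 _) (H 0%N); rewrite expr0 mulr1.
have [c Cc] : exists c : R, C = c%:C.
  by exists (complex.Re C); case: C C0 {H} => a b; rewrite lecE /= => /andP[/eqP ->].
have /cvg_ex[a ca] : cvg ((fun n => complex.Re (u n)) @ \oo).
  apply: (@real_geometric_cvg _ c) => n; rewrite -lecR rmorphM /= -complex_half -Cc.
  apply: le_trans (H n); rewrite -raddfB; exact: normc_ge_Re.
have /cvg_ex[b cb] : cvg ((fun n => complex.Im (u n)) @ \oo).
  apply: (@real_geometric_cvg _ c) => n; rewrite -lecR rmorphM /= -complex_half -Cc.
  apply: le_trans (H n); rewrite -raddfB; exact: norm_Im_le.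
apply/cvg_ex; exists (a +i* b); apply/cvgrPdist_lt => e /complex_gt0[x x0 ->].
have x2 : 0 < x / 2 by rewrite divr_gt0.
near=> n; apply: le_lt_trans (norm_le_ReIm _) _; rewrite ltcR [x]splitr.
rewrite !raddfB /=; apply: ltrD.
  by near: n; move/cvgrPdist_lt: ca; apply.
by near: n; move/cvgrPdist_lt: cb; apply.
Unshelve. all: by end_near. Qed.

End ComplexLimits.

(** * From convergent q-expansions to formal identities *)

Section Transfer.
Variable K : numClosedFieldType.
Hypothesis half_cvg0 : (fun n => 2^-1 ^+ n : K) @ \oo --> (0 : K).
Hypothesis geometric_cvg : forall (u : nat -> K) (C : K),
  (forall n, `|u n.+1 - u n| <= C * 2^-1 ^+ n) -> cvg (u @ \oo).
Local Notation "'P_' a" := (poch K a 5) (at level 2, a at level 1).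

(** Constant term 1 keeps [G] away from 0 near the origin, so the denominator clears and uniqueness
    of expansions applies. *)
Lemma expands_div (f g h : fps K) (F G : K -> K) :
  expands f (fun q => F q / G q) -> expands g G -> expands h F -> fcoef g 0 = 1 ->
  f * g = h.
Proof.
move=> ef eg eh g0; apply: (expands_unique _ eh).
apply: expands_near (expandsM half_cvg0 ef eg) _.
have := expands_neq0 eg g0; apply: filterS => q Gq.
by rewrite divfK.
Qed.

Lemma expands_poch5 a b c : (0 < a)%N -> (0 < b)%N -> (0 < c)%N ->
  expands (poch K a c ^+ 5 * poch K b c ^+ 5)
    (fun q => qpoch (q ^+ a) (q ^+ c) ^+ 5 * qpoch (q ^+ b) (q ^+ c) ^+ 5).
Proof.
move=> a0 b0 c0.
by apply: (expandsM half_cvg0); apply: (expandsX half_cvg0); apply: expands_qpoch.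
Qed.

Lemma poch5_ratio a b c d :
  (0 < a)%N -> (0 < b)%N -> (0 < c)%N -> (0 < d)%N -> forall f : fps K,
  expands f (fun q => (qpoch (q ^+ a) (q ^+ 5) ^+ 5 * qpoch (q ^+ b) (q ^+ 5) ^+ 5)
     / (qpoch (q ^+ c) (q ^+ 5) ^+ 5 * qpoch (q ^+ d) (q ^+ 5) ^+ 5)) ->
  f = (P_ a * P_ b * ipoch K c 5 * ipoch K d 5) ^+ 5.
Proof.
move=> a0 b0 c0 d0 f ef.
have p0 : fcoef (P_ c ^+ 5 * P_ d ^+ 5) 0 = 1.
  by rewrite (fcoef0M (_ ^+ _)) !fcoef0X !poch_0 !expr1n mulr1.
have E := expands_div ef (@expands_poch5 c d 5 c0 d0 isT) (@expands_poch5 a b 5 a0 b0 isT) p0.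
apply: (@fps_mulI _ (P_ c ^+ 5 * P_ d ^+ 5)); first by rewrite p0 oner_neq0.
rewrite mulrC E.
transitivity ((P_ a * P_ b * (P_ c * ipoch K c 5) * (P_ d * ipoch K d 5)) ^+ 5).
  by rewrite !poch_ipoch5 // !mulr1 exprMn.
ring.
Qed.

Variables A B D : nat -> int.

Lemma expansion_rri5 :
  is_qexpansion A (fun q : K =>
     (qpoch (q ^+ 2) (q ^+ 5) ^+ 5 * qpoch (q ^+ 3) (q ^+ 5) ^+ 5)
     / (qpoch q (q ^+ 5) ^+ 5 * qpoch (q ^+ 4) (q ^+ 5) ^+ 5)) ->
  Fps (fun n => (A n)%:~R) = rrg K ^+ 5.
Proof. by move=> /is_qexpansion_expands/(@poch5_ratio 2 3 1 4); apply. Qed.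

Lemma expansion_rr5 :
  is_qexpansion B (fun q : K =>
     (qpoch q (q ^+ 5) ^+ 5 * qpoch (q ^+ 4) (q ^+ 5) ^+ 5)
     / (qpoch (q ^+ 2) (q ^+ 5) ^+ 5 * qpoch (q ^+ 3) (q ^+ 5) ^+ 5)) ->
  Fps (fun n => (B n)%:~R) = rrf K ^+ 5.
Proof. by move=> /is_qexpansion_expands/(@poch5_ratio 1 4 2 3); apply. Qed.

Lemma expansion_rr_rri5 :
  is_qexpansion D (fun q : K =>
     (qpoch (q ^+ 5) (q ^+ 25) * qpoch (q ^+ 20) (q ^+ 25))
     / (qpoch (q ^+ 10) (q ^+ 25) * qpoch (q ^+ 15) (q ^+ 25))
     * ((qpoch (q ^+ 2) (q ^+ 5) ^+ 5 * qpoch (q ^+ 3) (q ^+ 5) ^+ 5)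
        / (qpoch q (q ^+ 5) ^+ 5 * qpoch (q ^+ 4) (q ^+ 5) ^+ 5))) ->
  Fps (fun n => (D n)%:~R) = sub5 (rrf K) * rrg K ^+ 5.
Proof.
move=> /is_qexpansion_expands; set f := Fps _ => ef.
have Q a b (a0 : (0 < a)%N) (b0 : (0 < b)%N) := expands_qpoch half_cvg0 geometric_cvg a0 b0.
pose G2 := poch K 10 25 * poch K 15 25.
have e2 : expands G2 _ := expandsM half_cvg0 (Q 10 25 isT isT) (Q 15 25 isT isT).
have e1 := expandsM half_cvg0 (Q 5 25 isT isT) (Q 20 25 isT isT).
have e4 : expands (P_ 1 ^+ 5 * P_ 4 ^+ 5) _ := @expands_poch5 1 4 5 isT isT isT.
have e3 := @expands_poch5 2 3 5 isT isT isT.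
have G20 : fcoef G2 0 = 1 by rewrite (fcoef0M (poch K 10 25)) !poch_0 mulr1.
have G40 : fcoef (P_ 1 ^+ 5 * P_ 4 ^+ 5) 0 = 1.
  by rewrite (fcoef0M (_ ^+ _)) !fcoef0X !poch_0 !expr1n mulr1.
(* Both quotients are merged into one, and their denominators cleared together. *)
have E : f * (G2 * (P_ 1 ^+ 5 * P_ 4 ^+ 5)) =
    poch K 5 25 * poch K 20 25 * (P_ 2 ^+ 5 * P_ 3 ^+ 5).
  apply: (expands_div _ (expandsM half_cvg0 e2 e4) (expandsM half_cvg0 e1 e3)).
    by apply: (expands_near ef); near=> q; rewrite mulf_div.
  by rewrite (fcoef0M G2) G20 G40 mulr1.
apply: (@fps_mulI _ (G2 * (P_ 1 ^+ 5 * P_ 4 ^+ 5))).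
  by rewrite (fcoef0M G2) G20 G40 mulr1 oner_neq0.
rewrite mulrC E.
have -> : G2 = sub5 (P_ 2 * P_ 3) by rewrite sub5M !sub5_poch.
have -> : poch K 5 25 * poch K 20 25 = sub5 (P_ 1 * P_ 4) by rewrite sub5M !sub5_poch.
have r1 : sub5 (P_ 1 * P_ 4) = sub5 (P_ 2 * P_ 3) * sub5 (rrf K).
  rewrite -(sub5M (_ * _)); congr sub5.
  rewrite (_ : _ * rrf K = P_ 1 * P_ 4 * (P_ 2 * ipoch K 2 5) * (P_ 3 * ipoch K 3 5)).
    by rewrite !poch_ipoch5 // !mulr1.
  rewrite /rrf; ring.
have r2 : P_ 2 * P_ 3 = P_ 1 * P_ 4 * rrg K.
  rewrite (_ : _ * rrg K = P_ 2 * P_ 3 * (P_ 1 * ipoch K 1 5) * (P_ 4 * ipoch K 4 5)).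
    by rewrite !poch_ipoch5 // !mulr1.
  rewrite /rrg; ring.
rewrite r1 -(exprMn _ P_ 2) r2; ring.
Unshelve. all: by end_near. Qed.

End Transfer.

Lemma fcoef_intr_lt0 (K : numDomainType) (c : nat -> int) (f : fps K) n :
  Fps (fun n => (c n)%:~R) = f -> fcoef f n < 0 -> c n < 0.
Proof. by move=> <-; rewrite ltrz0. Qed.

Theorem theorem1 (R : realType) (A B D : nat -> int)
  (hA : is_qexpansion (K := R[i]) A (fun q =>
     (qpoch (q ^+ 2) (q ^+ 5) ^+ 5 * qpoch (q ^+ 3) (q ^+ 5) ^+ 5)
     / (qpoch q (q ^+ 5) ^+ 5 * qpoch (q ^+ 4) (q ^+ 5) ^+ 5)))
  (hB : is_qexpansion (K := R[i]) B (fun q =>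
     (qpoch q (q ^+ 5) ^+ 5 * qpoch (q ^+ 4) (q ^+ 5) ^+ 5)
     / (qpoch (q ^+ 2) (q ^+ 5) ^+ 5 * qpoch (q ^+ 3) (q ^+ 5) ^+ 5)))
  (hD : is_qexpansion (K := R[i]) D (fun q =>
     (qpoch (q ^+ 5) (q ^+ 25) * qpoch (q ^+ 20) (q ^+ 25))
     / (qpoch (q ^+ 10) (q ^+ 25) * qpoch (q ^+ 15) (q ^+ 25))
     * ((qpoch (q ^+ 2) (q ^+ 5) ^+ 5 * qpoch (q ^+ 3) (q ^+ 5) ^+ 5)
        / (qpoch q (q ^+ 5) ^+ 5 * qpoch (q ^+ 4) (q ^+ 5) ^+ 5)))) :
  [/\ forall n : nat, (1 <= n)%N -> A (5 * n)%N < 0,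
      forall n : nat, (1 <= n)%N -> B (5 * n)%N < 0 &
      forall n : nat, 0 < D (5 * n + 1)%N].
Proof.
have h0 := @complex_half_cvg0 R; have h1 := @complex_geometric_cvg R.
have eA := @expansion_rri5 R[i] h0 h1 A hA.
have eB := @expansion_rr5 R[i] h0 h1 B hB.
have eD := @expansion_rr_rri5 R[i] h0 h1 D hD.
split=> [[//|n] _|[//|n] _|n].
- exact: fcoef_intr_lt0 eA (rri5_lt0 _ _).
- exact: fcoef_intr_lt0 eB (rr5_lt0 _ _).
by have := rr_rri5_gt0 R[i] n; rewrite -eD /= ltr0z.
Qed.
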